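(* Let $R$ be an Artinian standard graded ring and let $M$ be a finitely generated graded $R$-module. Let $A$ be a finite set of integers of the same parity (all even or all odd). If $M$ satisfies $(\mathsf{TR}_i)$ for all nonzero $i\in\mathbb{Z}\smallsetminus A$, then $M$ is totally reflexive.
   Context: All rings are commutative and Noetherian. A ring $R$ is standard graded if $R=\bigoplus_{i=0}^{\infty}R_i$ with $R_0=k$ a field and $R=R_0[R_1]$ (generated as a $k$-algebra by its degree one part). For an $R$-module $M$ set $M^*=\operatorname{Hom}_R(M,R)$. A finite (i.e. finitely generated) $R$-module $M$ is reflexive if the canonical map $M\to M^{**}$ is bijective. A finite $R$-module $M$ is totally reflexive if (i) $M$ is reflexive, (ii) $\operatorname{Ext}^i_R(M,R)=0$ for all $i>0$, and (iii) $\operatorname{Ext}^i_R(M^*,R)=0$ for all $i>0$. For a finite $R$-module $M$, choose a homomorphism $\phi\colon G\to F$ of finite free $R$-modules with $M=\operatorname{Coker}\phi$; the transpose of $M$ is $\operatorname{Tr}(M):=\operatorname{Coker}(\phi^* )$, where $\phi^*=\operatorname{Hom}_R(\phi,R)\colon F^*\to G^*$. It is unique up to projective equivalence (i.e. up to adding projective direct summands). For a nonzero integer $i$, the finite $R$-module $M$ satisfies condition $(\mathsf{TR}_i)$ provided $\operatorname{Ext}^i_R(M,R)=0$ if $i\ge 1$, and provided $\operatorname{Ext}^{-i}_R(\operatorname{Tr}(M),R)=0$ if $i\le -1$. No condition $(\mathsf{TR}_0)$ is defined; it is always assumed tacitly that $i\neq 0$. *)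

(* Defs.v *)
From HB Require Import structures.
From mathcomp Require Import all_boot all_order all_algebra.
From mathcomp Require Import boolp classical_sets functions cardinality.

Set Implicit Arguments.
Unset Strict Implicit.
Unset Printing Implicit Defensive.

Import GRing.Theory.
Local Open Scope ring_scope.
Local Open Scope quotient_scope.

(* Submodules are the library's [submodClosed] boolean predicates; in the
   presence of [boolp] every subset is given by such a predicate. *)

Section Submodule.
Variables (R : pzRingType) (V : lmodType R) (S : submodClosed V).

Record submod : Type := Submod { submod_val : V; _ : submod_val \in S }.

HB.instance Definition _ := [isSub for submod_val].
HB.instance Definition _ := [Choice of submod by <:].
HB.instance Definition _ := [SubChoice_isSubLmodule of submod by <:].

End Submodule.

Section Quotient.
Variables (R : pzRingType) (V : lmodType R) (S : submodClosed V).

(* [Quotient.quot] wants a [zmodClosed] predicate, and [submodClosed] does not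
   inherit from it. *)
Definition zmod_of : {pred V} := fun x => x \in S.

Lemma zmod_of_closed : zmod_closed zmod_of.
Proof.
split=> [|x y Sx Sy]; first exact: rpred0.
by rewrite -scaleN1r; apply: rpredD => //; apply: rpredZ.
Qed.

HB.instance Definition _ := GRing.isZmodClosed.Build V zmod_of zmod_of_closed.

Definition quotmod : Type := Quotient.quot zmod_of.

HB.instance Definition _ := GRing.Zmodule.on quotmod.

Definition quot_proj (x : V) : quotmod := \pi_(Quotient.quot zmod_of) x.

Definition quot_scale (a : R) (x : quotmod) : quotmod :=
  quot_proj (a *: repr (x : Quotient.quot zmod_of)).

Lemma quot_projE (x y : V) : (quot_proj x == quot_proj y) = (x - y \in S).
Proof. exact/esym/(Quotient.idealrBE zmod_of). Qed.

Lemma quot_proj_surj (q : quotmod) : exists x, quot_proj x = q.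
Proof. by exists (repr (q : Quotient.quot zmod_of)); rewrite /quot_proj reprK. Qed.

Lemma quot_projD (x y : V) : quot_proj (x + y) = quot_proj x + quot_proj y.
Proof. by rewrite /quot_proj raddfD. Qed.

Lemma quot_projZ a (x : V) : quot_proj (a *: x) = quot_scale a (quot_proj x).
Proof.
apply/eqP; rewrite /quot_scale quot_projE -scalerBr rpredZ //.
by rewrite -quot_projE /quot_proj reprK.
Qed.

Lemma quot_scaleA a b q :
  quot_scale a (quot_scale b q) = quot_scale (a * b) q.
Proof. by have [x <-] := quot_proj_surj q; rewrite -!quot_projZ scalerA. Qed.

Lemma quot_scale1 : left_id 1 quot_scale.
Proof.
by move=> q; have [x <-] := quot_proj_surj q; rewrite -quot_projZ scale1r.
Qed.

Lemma quot_scaleDr : right_distributive quot_scale +%R.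
Proof.
move=> a q r; have [x <-] := quot_proj_surj q.
have [y <-] := quot_proj_surj r.
by rewrite -quot_projD -!quot_projZ scalerDr quot_projD.
Qed.

Lemma quot_scaleDl q : {morph quot_scale^~ q : a b / a + b}.
Proof.
move=> a b; have [x <-] := quot_proj_surj q.
by rewrite -!quot_projZ scalerDl quot_projD.
Qed.

HB.instance Definition _ := GRing.Zmodule_isLmodule.Build R quotmod
  quot_scaleA quot_scale1 quot_scaleDr quot_scaleDl.

Lemma quot_proj_linear : linear quot_proj.
Proof. by move=> a x y; rewrite quot_projD quot_projZ. Qed.

HB.instance Definition _ :=
  GRing.isLinear.Build R V quotmod _ quot_proj quot_proj_linear.

End Quotient.

Section KerIm.
Variables (R : pzRingType) (U V W : lmodType R).

Definition ker_pred (g : {linear V -> W}) : {pred V} := fun x => g x == 0.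

Lemma ker_pred_closed g : submod_closed (ker_pred g).
Proof.
split=> [|a x y /eqP gx /eqP gy]; apply/eqP; first exact: linear0.
by rewrite linearP gx gy scaler0 addr0.
Qed.

HB.instance Definition _ g :=
  GRing.isSubmodClosed.Build R V (ker_pred g) (ker_pred_closed g).

Definition im_pred (f : {linear U -> V}) : {pred V} :=
  fun y => `[< exists x, f x = y >].

Lemma im_pred_closed f : submod_closed (im_pred f).
Proof.
split=> [|a _ _ /asboolP[x <-] /asboolP[y <-]]; apply/asboolP.
  by exists 0; rewrite linear0.
by exists (a *: x + y); rewrite linearP.
Qed.

HB.instance Definition _ f :=
  GRing.isSubmodClosed.Build R V (im_pred f) (im_pred_closed f).

Definition ker (g : {linear V -> W}) := submod (ker_pred g).

Definition coker (f : {linear U -> V}) := quotmod (im_pred f).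

Definition cobound_pred (f : {linear U -> V}) (g : {linear V -> W}) :
    {pred ker g} := fun y => val y \in im_pred f.

Lemma cobound_pred_closed f g : submod_closed (@cobound_pred f g).
Proof.
split=> [|a x y fx fy]; rewrite unfold_in /cobound_pred.
  by rewrite linear0 rpred0.
by rewrite linearP; apply: rpredD => //; apply: rpredZ.
Qed.

HB.instance Definition _ f g := GRing.isSubmodClosed.Build R (ker g)
  (@cobound_pred f g) (@cobound_pred_closed f g).

(* The homology at [V] of the complex [U --f--> V --g--> W]. *)
Definition homology (f : {linear U -> V}) (g : {linear V -> W}) :=
  quotmod (@cobound_pred f g).

End KerIm.

HB.instance Definition _ (R : pzRingType) (V W : lmodType R)
  (g : {linear V -> W}) := GRing.Lmodule.on (ker g).
HB.instance Definition _ (R : pzRingType) (U V : lmodType R)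
  (f : {linear U -> V}) := GRing.Lmodule.on (coker f).
HB.instance Definition _ (R : pzRingType) (U V W : lmodType R)
  (f : {linear U -> V}) (g : {linear V -> W}) :=
  GRing.Lmodule.on (homology f g).

Section Hom.
Variables (R : comNzRingType) (U V : lmodType R).

Definition linear_pred : {pred U -> V} := fun f => `[< linear f >].

Lemma linear_pred_closed : submod_closed linear_pred.
Proof.
split=> [|a f g /asboolP lf /asboolP lg]; apply/asboolP.
  by move=> a x y; rewrite /= scaler0 addr0.
move=> b x y; rewrite !fctE lf lg !scalerDr !scalerA.
by rewrite (mulrC a b) addrACA.
Qed.

HB.instance Definition _ :=
  GRing.isSubmodClosed.Build R (U -> V) linear_pred linear_pred_closed.

Definition hom := submod linear_pred.

HB.instance Definition _ := GRing.Lmodule.on hom.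

Definition hom_fun (f : hom) : U -> V := val f.

Lemma hom_fun_linear f : linear (hom_fun f).
Proof. exact/asboolP/(valP f). Qed.

HB.instance Definition _ (f : hom) :=
  GRing.isLinear.Build R U V _ (hom_fun f) (hom_fun_linear f).

Lemma linear_in (f : {linear U -> V}) : (f : U -> V) \in linear_pred.
Proof. by apply/asboolP => a x y; rewrite linearP. Qed.

Definition to_hom (f : {linear U -> V}) : hom := Sub (f : U -> V) (linear_in f).

Lemma homP (f g : hom) : f = g <-> hom_fun f =1 hom_fun g.
Proof. by split=> [->//|fg]; apply/val_inj/funext. Qed.

End Hom.

Coercion hom_fun : hom >-> Funclass.

(* The contravariant functor Hom(-, N) on maps. *)
Section HomMap.
Variables (R : comNzRingType) (N U V : lmodType R) (phi : {linear U -> V}).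

Definition hom_map (f : hom V N) : hom U N := to_hom (f \o phi).

Lemma hom_map_linear : linear hom_map.
Proof. by move=> a f g; apply/val_inj/funext. Qed.

HB.instance Definition _ :=
  GRing.isLinear.Build R (hom V N) (hom U N) _ hom_map hom_map_linear.

End HomMap.
Arguments hom_map {R} N {U V} phi.

Definition dual (R : comNzRingType) (M : lmodType R) := hom M R^o.

HB.instance Definition _ (R : comNzRingType) (M : lmodType R) :=
  GRing.Lmodule.on (dual M).

Section Biduality.
Variables (R : comNzRingType) (M : lmodType R).

Definition eval_at (x : M) (f : dual M) : R^o := (f : hom M R^o) x.

Lemma eval_at_linear x : linear (eval_at x).
Proof. by []. Qed.

HB.instance Definition _ x :=
  GRing.isLinear.Build R (dual M) R^o _ (eval_at x) (eval_at_linear x).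

Definition biduality (x : M) : dual (dual M) := to_hom (eval_at x).

End Biduality.

Definition exact_at (R : pzRingType) (U V W : lmodType R)
    (f : {linear U -> V}) (g : {linear V -> W}) : Prop :=
  forall y : V, g y = 0 <-> exists x : U, f x = y.

Definition surjective (U V : Type) (f : U -> V) : Prop :=
  forall y, exists x, f x = y.

(* ... -> R^(n 2) -> R^(n 1) -> R^(n 0) -> M -> 0 *)
Record free_resolution (R : comNzRingType) (M : lmodType R) := FreeResolution {
  res_rank : nat -> nat;
  res_diff : forall i,
    {linear 'rV[R]_(res_rank i.+1) -> 'rV[R]_(res_rank i)};
  res_aug : {linear 'rV[R]_(res_rank 0) -> M};
  res_aug_surj : surjective res_aug;
  res_aug_exact : exact_at (res_diff 0) res_aug;
  res_diff_exact : forall i, exact_at (res_diff i.+1) (res_diff i)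
}.

(* The cohomology of Hom(P, N), for [P] a resolution of [M] by finite free
   modules. *)
Definition Ext (R : comNzRingType) (M : lmodType R) (P : free_resolution M)
    (i : nat) (N : lmodType R) : lmodType R :=
  if i is j.+1 then
    homology (hom_map N (res_diff P j)) (hom_map N (res_diff P j.+1))
  else ker (hom_map N (res_diff P 0)).

Definition Ext_eq0 (R : comNzRingType) (i : nat) (M N : lmodType R) : Prop :=
  exists P : free_resolution M, forall x : Ext P i N, x = 0.

Section Independence.
Variables (R : comNzRingType) (M N : lmodType R).

Lemma Ext_eq0P (P : free_resolution M) i :
  (forall x : Ext P i.+1 N, x = 0) <->
  forall f : {linear 'rV[R]_(res_rank P i.+1) -> N},
    (forall x, f (res_diff P i.+1 x) = 0) ->
    exists g : {linear 'rV[R]_(res_rank P i) -> N},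
      forall x, f x = g (res_diff P i x).
Proof.
split=> [E f f0|E q].
  have fker : to_hom f \in ker_pred (hom_map N (res_diff P i.+1)).
    by apply/eqP/homP => x; apply: f0.
  have /eqP := E (quot_proj _ (Submod fker)).
  rewrite -(linear0 (quot_proj _)) quot_projE subr0 => /asboolP[g gE].
  exists (hom_fun g) => x.
  by have /homP/(_ x) := gE.
have [[f fker] <-] := quot_proj_surj q.
apply/eqP; rewrite -(linear0 (quot_proj _)) quot_projE subr0.
have f0 x : hom_fun f (res_diff P i.+1 x) = 0.
  by have /eqP/homP/(_ x) := fker.
have [g gE] := E (hom_fun f) f0.
by apply/asboolP; exists (to_hom g); apply/homP => x; apply/esym/gE.
Qed.

Lemma free_lift n (U W : lmodType R) (p : {linear U -> W})
    (h : {linear 'rV[R]_n -> W}) :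
  (forall x, exists u, p u = h x) ->
  exists l : {linear 'rV[R]_n -> U}, forall x, p (l x) = h x.
Proof.
move=> hp; pose u j := projT1 (cid (hp (delta_mx 0 j))).
have uE j : p (u j) = h (delta_mx 0 j) by rewrite /u; case: cid.
pose l (x : 'rV[R]_n) := \sum_j x 0 j *: u j.
have ll : linear l.
  move=> a x y; rewrite /l scaler_sumr -big_split; apply: eq_bigr => j _ /=.
  by rewrite !mxE scalerDl scalerA.
pose lm := GRing.isLinear.Build _ _ _ _ l ll.
pose L : {linear 'rV[R]_n -> U} := HB.pack l lm.
exists L => x; rewrite /= /l linear_sum [x in RHS]row_sum_delta linear_sum.
by apply: eq_bigr => j _; rewrite !linearZ uE.
Qed.

(* Chain maps over the identity of [M] and a homotopy, in degrees i, i + 1. *)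
Lemma res_compare (P Q : free_resolution M) i :
  exists (a : {linear 'rV[R]_(res_rank P i) -> 'rV[R]_(res_rank Q i)})
         (a' : {linear 'rV[R]_(res_rank P i.+1) -> 'rV[R]_(res_rank Q i.+1)})
         (b : {linear 'rV[R]_(res_rank Q i) -> 'rV[R]_(res_rank P i)})
         (b' : {linear 'rV[R]_(res_rank Q i.+1) -> 'rV[R]_(res_rank P i.+1)})
         (s : {linear 'rV[R]_(res_rank P i) -> 'rV[R]_(res_rank P i.+1)}),
  [/\ forall x, res_diff Q i (a' x) = a (res_diff P i x),
      forall x, res_diff P i (b' x) = b (res_diff Q i x) &
      forall x, res_diff P i (x - b' (a' x) - s (res_diff P i x)) = 0].
Proof.
have dd (S : free_resolution M) j x : res_diff S j (res_diff S j.+1 x) = 0.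
  by apply/res_diff_exact; exists x.
have ad (S : free_resolution M) x : res_aug S (res_diff S 0 x) = 0.
  by apply/res_aug_exact; exists x.
elim: i => [|i [a [a' [b [b' [s [aE bE sE]]]]]]].
  have step0 (S T : free_resolution M) :
      exists c : {linear 'rV[R]_(res_rank S 0) -> 'rV[R]_(res_rank T 0)},
      exists c' : {linear 'rV[R]_(res_rank S 1) -> 'rV[R]_(res_rank T 1)},
      (forall x, res_aug T (c x) = res_aug S x) /\
      (forall x, res_diff T 0 (c' x) = c (res_diff S 0 x)).
    have [c cE] := free_lift (fun x => res_aug_surj T (res_aug S x)).
    have [|c' c'E] := @free_lift _ _ _ (res_diff T 0) (c \o res_diff S 0).
      by move=> x; apply/res_aug_exact; rewrite /= cE ad.
    by exists c, c'.
  have [a [a' [aE a'E]]] := step0 P Q.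
  have [b [b' [bE b'E]]] := step0 Q P.
  have [|s sE] := @free_lift _ _ _ (res_diff P 0) (idfun \- (b \o a)).
    by move=> x; apply/res_aug_exact; rewrite linearB /= bE aE subrr.
  exists a, a', b, b', s; split=> // x.
  by rewrite !linearB sE /= b'E a'E /= subrr.
have [|a2 a2E] :=
  @free_lift _ _ _ (res_diff Q i.+1) (a' \o res_diff P i.+1).
  by move=> x; apply/res_diff_exact; rewrite /= aE dd linear0.
have [|b2 b2E] :=
  @free_lift _ _ _ (res_diff P i.+1) (b' \o res_diff Q i.+1).
  by move=> x; apply/res_diff_exact; rewrite /= bE dd linear0.
have [|t tE] := @free_lift _ _ _ (res_diff P i.+1)
  (idfun \- (b' \o a') \- (s \o res_diff P i)).
  by move=> x; apply/res_diff_exact; rewrite -[RHS](sE x).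
exists a', a2, b', b2, t; split=> // x.
by rewrite !linearB tE /= b2E /= a2E /= dd linear0 subr0 subrr.
Qed.

(* [Ext_eq0] does not depend on the choice of the resolution. *)
Lemma Ext_eq0_indep (P Q : free_resolution M) i :
  (forall x : Ext Q i.+1 N, x = 0) -> forall x : Ext P i.+1 N, x = 0.
Proof.
move=> /Ext_eq0P E; apply/Ext_eq0P => f f0.
have [a [a' [b [b' [s [aE bE sE]]]]]] := res_compare P Q i.
have [x|g gE] := E (f \o b').
  have dd (S : free_resolution M) j y : res_diff S j (res_diff S j.+1 y) = 0.
    by apply/res_diff_exact; exists y.
  have /res_diff_exact[y yE] : res_diff P i (b' (res_diff Q i.+1 x)) = 0.
    by rewrite bE dd linear0.
  by rewrite /= -yE f0.
exists ((g \o a) \+ (f \o s)) => x.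
have /res_diff_exact[y yE] := sE x.
have /eqP := f0 y; rewrite yE !linearB /= subr_eq0 => /eqP <-.
by rewrite -aE -gE /= addrC subrK.
Qed.

End Independence.

(* R^m --phi--> R^n -> M -> 0 *)
Record free_presentation (R : comNzRingType) (M : lmodType R) :=
  FreePresentation {
  pres_src : nat;
  pres_tgt : nat;
  pres_map : {linear 'rV[R]_pres_src -> 'rV[R]_pres_tgt};
  pres_aug : {linear 'rV[R]_pres_tgt -> M};
  pres_aug_surj : surjective pres_aug;
  pres_exact : exact_at pres_map pres_aug
}.

Definition Tr (R : comNzRingType) (M : lmodType R)
    (phi : free_presentation M) : lmodType R :=
  coker (hom_map R^o (pres_map phi)).

(* No condition is imposed for [i = 0]. *)
Definition TR (R : comNzRingType) (i : int) (M : lmodType R) : Prop :=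
  (1 <= i -> Ext_eq0 `|i|%N M R^o) /\
  (i <= -1 -> exists phi : free_presentation M, Ext_eq0 `|i|%N (Tr phi) R^o).

Definition finite_module (R : pzRingType) (M : lmodType R) : Prop :=
  exists (n : nat) (e : 'I_n -> M),
    forall x, exists c : 'I_n -> R, x = \sum_i c i *: e i.

(* Ideals are the submodules of [R^o]. *)
Definition noetherian (R : comNzRingType) : Prop :=
  forall I : nat -> submodClosed R^o,
    (forall n, {subset I n <= I n.+1}) ->
    exists n, forall m, (n <= m)%N -> I m =i I n.

Definition artinian (R : comNzRingType) : Prop :=
  forall I : nat -> submodClosed R^o,
    (forall n, {subset I n.+1 <= I n}) ->
    exists n, forall m, (n <= m)%N -> I m =i I n.

Definition reflexive_module (R : comNzRingType) (M : lmodType R) : Prop :=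
  finite_module M /\ bijective (@biduality R M).

Definition totally_reflexive (R : comNzRingType) (M : lmodType R) : Prop :=
  [/\ reflexive_module M,
      forall i, (0 < i)%N -> Ext_eq0 i M R^o &
      forall i, (0 < i)%N -> Ext_eq0 i (dual M) R^o].

Definition direct_sum (I : eqType) (V : zmodType) (G : I -> zmodClosed V) :
    Prop :=
  (forall x, exists (s : seq I) (c : I -> V),
     [/\ uniq s, forall i, c i \in G i & x = \sum_(i <- s) c i]) /\
  (forall (s : seq I) (c : I -> V),
     uniq s -> (forall i, c i \in G i) -> \sum_(i <- s) c i = 0 ->
     {in s, forall i, c i = 0}).

(* R_0 is the field [k] of scalars, and R = k[R_1]. *)
Definition standard_graded (k : fieldType) (R : comAlgType k)
    (Rg : nat -> zmodClosed R) : Prop :=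
  [/\ direct_sum Rg,
      forall i j x y, x \in Rg i -> y \in Rg j -> x * y \in Rg (i + j)%N,
      forall x, x \in Rg 0%N <-> exists c : k, x = c%:A &
      forall S : subalgClosed R, {subset Rg 1%N <= S} -> forall x, x \in S].

Definition graded_module (R : comNzRingType) (Rg : nat -> zmodClosed R)
    (M : lmodType R) (Mg : int -> zmodClosed M) : Prop :=
  direct_sum Mg /\
  forall i j a x, a \in Rg i -> x \in Mg j -> a *: x \in Mg (i%:Z + j).

(* Main.v *)
Require Import Defs.
From HB Require Import structures.
From mathcomp Require Import all_boot all_order all_algebra.
From mathcomp Require Import boolp classical_sets functions cardinality.
From mathcomp Require Import zify ring.

Set Implicit Arguments.
Unset Strict Implicit.
Unset Printing Implicit Defensive.

Import Order.TTheory GRing.Theory Num.Theory.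
Local Open Scope ring_scope.

(** Why the theorem holds.

    Let [F] be a graded free resolution of [M] with matrices [B_i], and write
    [X^] for the dual of a free module [X].  Resolve the kernel of the
    transpose of [B_0], a graded submodule of [H_0 = F_0^], by graded free
    modules [H_1], [H_2], and so on.  Gluing gives a doubly infinite complex
      C :   H_2 -> H_1 -> H_0 = F_0^ -> F_1^ -> F_2^
    which is exact at every [H_i] and has cohomology [Ext^i(M, R)] at [F_i^] for
    [i > 0].
    The kernel that was resolved is the dual of [M], so the dual complex
      F_2 -> F_1 -> F_0 -> H_1^ -> H_2^
    is exact at [F_i] for [i > 0], exact at [F_0] when [M] embeds in its
    bidual, exact at [H_1^] when [M] maps onto its bidual, and has cohomology
    [Ext^(i-1)(dual M, R)] at [H_i^] for [i > 1].  In terms of the transpose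
    these are [Ext^(i+1)(Tr M, R)] at the [i]-th place.  Hence each condition
    TR_i is exactness at one place of one of the two complexes, and [M] is
    totally reflexive exactly when both complexes are exact everywhere.

    Since [R_0] is the field [k], taking a [k]-basis of each kernel as the set
    of generators makes the degrees of the generators grow by at least one at
    each step ([resolution_step]).  As [R] has finite dimension over [k]
    ([hombasis_exists]), only finitely many terms of the complexes live in a
    given degree.  In each degree the alternating sum of the dimensions of the
    terms is therefore the alternating sum of the dimensions of the cohomology
    ([alternating_sum], [euler_defect]).  If [A] has parity [p], the cohomology
    of [C] sits at places of parity [p], while that of the dual complex sits at
    places of the other parity, because TR_(-i-1) is exactness at the [i]-th
    place.  So the first alternating sum is [(-1)^p] times a nonnegative number
    and the second is [- (-1)^p] times a nonnegative number.

    The two alternating sums are not independent: as formal series in the degree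
    they are [h(t) P(t)] and [h(t) P(1/t)], with [h] the Hilbert series of [R]
    and [P] the signed generating function of the degrees of the generators.
    Multiplying both by [h(1/t)] makes them agree up to [t -> 1/t], which is
    [euler_duality].  Two sums of nonnegative numbers are then opposite to
    each other, so all of them vanish ([exact_of_parity]).

    What remains is the dictionary with the module-theoretic conditions: a
    resolution of the dual of [M] extends any presentation of [M] to a
    resolution of the transpose ([tr_resolution]), which expresses the
    vanishing of [Ext^i(Tr M, R)] by conditions that do not mention the
    presentation. *)

(** * Homogeneous components in a direct sum *)

Section DirectSum.
Variables (I : eqType) (V : zmodType) (G : I -> zmodClosed V).
Hypothesis dirG : direct_sum G.

(** Both families are extended by zero to the union of the two index lists, where
    the independence of the summands applies to their difference. *)
Lemma direct_sum_uniq (s t : seq I) (c d : I -> V) :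
    uniq s -> uniq t -> (forall i, c i \in G i) -> (forall i, d i \in G i) ->
    (forall i, i \notin s -> c i = 0) -> (forall i, i \notin t -> d i = 0) ->
    \sum_(i <- s) c i = \sum_(i <- t) d i -> c =1 d.
Proof.
move=> us ut Gc Gd cs dt eq_cd.
have ext (r : seq I) (f : I -> V) : uniq r -> (forall i, i \notin r -> f i = 0) ->
    {subset r <= undup (s ++ t)} ->
    \sum_(i <- undup (s ++ t)) f i = \sum_(i <- r) f i.
  move=> ur f0 sub; rewrite (bigID (mem r)) /= [X in _ + X]big1 ?addr0 //.
  rewrite -big_filter; apply: perm_big; apply: uniq_perm => //.
    by rewrite filter_uniq ?undup_uniq.
  by move=> i; rewrite mem_filter andb_idr // => /sub.
have sum0 : \sum_(i <- undup (s ++ t)) (c i - d i) = 0.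
  rewrite sumrB (ext s c us cs) ?(ext t d ut dt) ?eq_cd ?subrr // => i;
  by rewrite mem_undup mem_cat => ->; rewrite ?orbT.
have [_ dir0] := dirG.
have cd0 := dir0 _ _ (undup_uniq _) (fun i => rpredB (Gc i) (Gd i)) sum0.
move=> i.
have [st_i|] := boolP (i \in undup (s ++ t)).
  by apply/eqP; rewrite -subr_eq0; apply/eqP/cd0.
by rewrite mem_undup mem_cat negb_or => /andP[/cs-> /dt->].
Qed.

Lemma direct_sum_dec x : exists sc : seq I * (I -> V),
  [/\ uniq sc.1, forall i, sc.2 i \in G i, forall i, i \notin sc.1 -> sc.2 i = 0
    & x = \sum_(i <- sc.1) sc.2 i].
Proof.
have [/(_ x)[s [c [us Gc ->]]] _] := dirG.
exists (s, fun i => if i \in s then c i else 0); split=> //= [i|i /negPf->//|].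
  by case: ifP => // _; apply: rpred0.
by rewrite big_seq [RHS]big_seq; apply: eq_bigr => i ->.
Qed.

(** [hsupp x] is only some finite list outside which the components of [x] vanish:
    it may contain indices of zero components. *)
Definition hsupp x := (projT1 (cid (direct_sum_dec x))).1.
Definition hpart i x := (projT1 (cid (direct_sum_dec x))).2 i.

Lemma hsupp_uniq x : uniq (hsupp x).
Proof. by rewrite /hsupp; case: cid => ? []. Qed.

Lemma hpart_in i x : hpart i x \in G i.
Proof. by rewrite /hpart; case: cid => ? []. Qed.

Lemma hpart_out i x : i \notin hsupp x -> hpart i x = 0.
Proof. by rewrite /hpart /hsupp; case: cid => ? [] /= _ _ + _; apply. Qed.

Lemma hpart_sum x : x = \sum_(i <- hsupp x) hpart i x.
Proof. by rewrite /hpart /hsupp; case: cid => ? []. Qed.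

Lemma hpart_sum_sub s x : uniq s -> {subset hsupp x <= s} ->
  x = \sum_(i <- s) hpart i x.
Proof.
move=> us sub; rewrite [LHS]hpart_sum [RHS](bigID (mem (hsupp x))) /=.
rewrite [X in _ + X]big1 ?addr0; last by move=> i; apply: hpart_out.
rewrite -[RHS]big_filter; apply: perm_big; apply: uniq_perm.
- exact: hsupp_uniq.
- by rewrite filter_uniq.
by move=> i; rewrite mem_filter andb_idr // => /sub.
Qed.

Lemma hpartE s (c : I -> V) i : uniq s -> (forall i, c i \in G i) ->
  (forall i, i \notin s -> c i = 0) -> hpart i (\sum_(j <- s) c j) = c i.
Proof.
move=> us Gc cs; apply: (direct_sum_uniq (hsupp_uniq _) us) => //.
- by move=> j; apply: hpart_in.
- by move=> j; apply: hpart_out.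
exact/esym/hpart_sum.
Qed.

Lemma hpart_hom i j x : x \in G i -> hpart j x = if j == i then x else 0.
Proof.
move=> Gx; transitivity (hpart j (\sum_(l <- [:: i]) (if l == i then x else 0))).
  by rewrite !big_seq1 eqxx.
rewrite (@hpartE [:: i] (fun l => if l == i then x else 0)) // => l.
  by case: eqP => [->|_] //; apply: rpred0.
by rewrite inE => /negPf->.
Qed.

Lemma hpart_is_zmod_morphism i : zmod_morphism (hpart i).
Proof.
move=> x y; pose s := undup (hsupp x ++ hsupp y).
have sx : {subset hsupp x <= s}.
  by move=> j; rewrite mem_undup mem_cat => ->.
have sy : {subset hsupp y <= s}.
  by move=> j; rewrite mem_undup mem_cat orbC => ->.
have -> : x - y = \sum_(j <- s) (hpart j x - hpart j y).
  by rewrite sumrB -!hpart_sum_sub ?undup_uniq.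
rewrite (@hpartE s (fun i => hpart i x - hpart i y)) ?undup_uniq // => j.
  by rewrite rpredB ?hpart_in.
by rewrite mem_undup mem_cat negb_or => /andP[? ?]; rewrite !hpart_out ?subrr.
Qed.

HB.instance Definition _ i :=
  GRing.isZmodMorphism.Build V V (hpart i) (hpart_is_zmod_morphism i).

Lemma hpart_ext x y : (forall i, hpart i x = hpart i y) -> x = y.
Proof.
move=> xy; apply/eqP; rewrite -subr_eq0 [X in X == 0]hpart_sum big1 // => i _.
by rewrite raddfB /= xy subrr.
Qed.

Lemma hpart_sum_over s x : uniq s -> (forall i, i \notin s -> hpart i x = 0) ->
  x = \sum_(i <- s) hpart i x.
Proof.
move=> us xs; apply: hpart_ext => i; rewrite (@hpartE s (hpart^~ x)) // => j.
exact: hpart_in.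
Qed.

End DirectSum.

(** * A homogeneous basis of the ring over its ground field *)

(** A homogeneous [k]-basis of [R].  The last two fields are the two facts about the
    grading of [R] on which the argument rests: degrees add up under
    multiplication, and the part of degree zero is the field of scalars. *)
Record hombasis (k : fieldType) (R : comAlgType k) := HomBasis {
  hb_size : nat;
  hb_elt : 'I_hb_size -> R;
  hb_wt : 'I_hb_size -> nat;
  hb_free : forall c : 'I_hb_size -> k,
    \sum_l c l *: hb_elt l = 0 -> forall l, c l = 0;
  hb_span : forall x, exists c : 'I_hb_size -> k, x = \sum_l c l *: hb_elt l;
  hb_mul : forall l l', exists c : 'I_hb_size -> k,
    (forall m, c m != 0 -> hb_wt m = (hb_wt l + hb_wt l')%N) /\
    hb_elt l * hb_elt l' = \sum_m c m *: hb_elt m;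
  hb_wt0 : forall l, hb_wt l = 0%N -> exists c : k, hb_elt l = c%:A
}.

Section HomBasisExists.
Variables (k : fieldType) (R : comAlgType k) (Rg : nat -> zmodClosed R).
Hypotheses (noethR : noetherian R) (artR : artinian R).
Hypothesis gradR : standard_graded Rg.

Let dirR : direct_sum Rg. Proof. by case: gradR. Qed.
Let RgM i j x y : x \in Rg i -> y \in Rg j -> x * y \in Rg (i + j)%N.
Proof. by case: gradR => _ + _ _; apply. Qed.
Let Rg0 x : x \in Rg 0%N <-> exists c : k, x = c%:A.
Proof. by case: gradR. Qed.

Lemma Rg_scale d c x : x \in Rg d -> c *: x \in Rg d.
Proof.
by move=> Rx; rewrite -mulr_algl -[d]add0n RgM //; apply/Rg0; exists c.
Qed.

Lemma hpart_mul d i x y : x \in Rg i ->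
  hpart dirR d (x * y) = if (i <= d)%N then x * hpart dirR (d - i)%N y else 0.
Proof.
move=> Rx; rewrite [y in LHS](hpart_sum dirR) mulr_sumr raddf_sum /=.
have E j : hpart dirR d (x * hpart dirR j y) =
    if (i + j == d)%N then x * hpart dirR j y else 0.
  by rewrite (hpart_hom dirR _ (RgM Rx (hpart_in dirR j y))) eq_sym.
under eq_bigr => j _ do rewrite E.
case: leqP => [le_id|lt_di]; last first.
  by rewrite big1 // => j _; rewrite gtn_eqF // ltn_addr.
have [in_s|out_s] := boolP ((d - i)%N \in hsupp dirR y); last first.
  rewrite (hpart_out out_s) mulr0 big_seq big1 // => j js.
  by case: eqP => // eq_d; move: out_s; rewrite -eq_d addKn js.
rewrite (bigD1_seq (d - i)%N) ?hsupp_uniq //= subnKC // eqxx big1 ?addr0 // => j nj.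
by case: eqP => // eq_d; move: nj; rewrite -eq_d addKn eqxx.
Qed.

(** The elements without components of degree less than [d] form an ideal, on which
    [a] acts in degree [d] through its component of degree zero, a scalar.  So any
    [k]-subspace of [R_d], together with everything of higher degree, is an ideal. *)
Lemma hpart_mul_low d a y : (forall j, (j < d)%N -> hpart dirR j y = 0) ->
  (forall j, (j < d)%N -> hpart dirR j (a * y) = 0) /\
  hpart dirR d (a * y) = hpart dirR 0%N a * hpart dirR d y.
Proof.
move=> y0; split=> [j lt_jd|].
  rewrite [a](hpart_sum dirR) mulr_suml raddf_sum big1 //= => i _.
  rewrite (hpart_mul _ _ (hpart_in _ _ _)); case: ifP => // _.
  by rewrite y0 ?mulr0 // (leq_ltn_trans (leq_subr _ _)).
rewrite [a in LHS](hpart_sum dirR) mulr_suml raddf_sum /=.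
have E i : hpart dirR d (hpart dirR i a * y) =
    if i == 0%N then hpart dirR 0%N a * hpart dirR d y else 0.
  rewrite (hpart_mul _ _ (hpart_in _ _ _)).
  case: i => [|i]; first by rewrite subn0.
  case: ifP => // lt_id; rewrite y0 ?mulr0 //=; lia.
under eq_bigr => i _ do rewrite E.
have [in_s|out_s] := boolP (0%N \in hsupp dirR a).
  by rewrite (bigD1_seq 0%N) ?hsupp_uniq //= big1 ?addr0 // => i /negPf->.
rewrite (hpart_out out_s) mul0r big_seq big1 // => i si.
by case: eqP => // i0; move: out_s; rewrite -i0 si.
Qed.

Definition submod_of (V : lmodType R) (P : {pred V}) (cP : submod_closed P) :
  submodClosed V := HB.pack P (GRing.isSubmodClosed.Build R V P cP).

Definition ge_pred n : {pred R^o} :=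
  fun y => `[< forall j, (j < n)%N -> hpart dirR j (y : R) = 0 >].

Lemma ge_pred_closed n : submod_closed (ge_pred n).
Proof.
split=> [|a x y /asboolP x0 /asboolP y0]; apply/asboolP => j lt_jn.
  by rewrite raddf0.
rewrite raddfD /= y0 // addr0.
by have [ax0 _] := hpart_mul_low a x0; apply: ax0.
Qed.

(** The ideals of elements of degree at least [n] form a descending chain. *)
Lemma graded_bounded : exists s, forall d x, (s <= d)%N -> x \in Rg d -> x = 0.
Proof.
have [|s sP] := artR (I := fun n => submod_of (ge_pred_closed n)).
  move=> n x /asboolP x0; apply/asboolP => j lt_jn; apply: x0; exact: ltnW.
exists s => d x le_sd Rx.
have x_s : (x : R^o) \in ge_pred s.
  apply/asboolP => j lt_js; rewrite (hpart_hom dirR _ Rx).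
  by case: eqP => // eq_jd; move: le_sd; rewrite -eq_jd leqNgt lt_js.
have : (x : R^o) \in ge_pred d.+1 by rewrite (sP _ (leqW le_sd)).
by move=> /asboolP/(_ d (ltnSn d)); rewrite (hpart_hom dirR _ Rx) eqxx.
Qed.

(** Otherwise there is an infinite sequence in [R_d], no term of which is a
    [k]-combination of the earlier ones.  The spans of its initial segments,
    enlarged by all elements of degree greater than [d], are then a strictly
    ascending chain of ideals. *)
Lemma graded_part_finite d : exists n (x : nat -> R), (forall i, x i \in Rg d) /\
  forall y, y \in Rg d -> exists c : nat -> k, y = \sum_(i < n) c i *: x i.
Proof.
apply: contrapT => noP.
have next (s : seq R) : exists y, (all [in Rg d] s ->
    y \in Rg d /\ forall c : nat -> k, y <> \sum_(i < size s) c i *: s`_i).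
  have [Rs|] := boolP (all [in Rg d] s); last by exists 0.
  apply: contrapT => noy; apply: noP; exists (size s), (nth 0 s); split.
    move=> i; have [lt_is|le_si] := ltnP i (size s); last first.
      by rewrite nth_default // rpred0.
    by move/allP: Rs; apply; rewrite mem_nth.
  move=> y Ry; apply: contrapT => noc; apply: noy; exists y => _; split=> // c yE.
  by apply: noc; exists c.
have [g gP] := choice next.
pose L := fix L n := if n is m.+1 then rcons (L m) (g (L m)) else [::].
pose x n := g (L n).
have LE n : L n = mkseq x n by elim: n => //= n IHn; rewrite IHn mkseqS -IHn.
have RL n : all [in Rg d] (L n).
  by elim: n => //= n IHn; rewrite all_rcons IHn andbT /= (gP _ IHn).1.
have Rx n : x n \in Rg d by apply: (gP _ (RL n)).1.
have xN n (c : nat -> k) : x n <> \sum_(i < n) c i *: x i.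
  move=> xE; apply: ((gP _ (RL n)).2 c); rewrite -/(x n) xE LE size_mkseq.
  by apply: eq_bigr => i _; rewrite nth_mkseq.
pose P n : {pred R^o} := fun y => `[< (forall j, (j < d)%N -> hpart dirR j (y : R) = 0)
   /\ exists c : nat -> k, hpart dirR d (y : R) = \sum_(i < n) c i *: x i >].
have cP n : submod_closed (P n).
  split=> [|a y z /asboolP[y0 [c yE]] /asboolP[z0 [e zE]]]; apply/asboolP.
    split=> [j _|]; first by rewrite raddf0.
    by exists (fun=> 0); rewrite raddf0 big1 // => i _; rewrite scale0r.
  have [ay0 ayE] := hpart_mul_low a y0.
  split=> [j lt_jd|]; first by rewrite raddfD /= ay0 // z0 ?addr0.
  have /Rg0[b bE] := hpart_in dirR 0%N a.
  exists (fun i => b * c i + e i).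
  rewrite raddfD /= ayE zE yE bE mulr_algl scaler_sumr -big_split.
  by apply: eq_bigr => i _; rewrite scalerA scalerDl.
have [|n nP] := noethR (I := fun n => submod_of (cP n)).
  move=> n y /asboolP[y0 [c yE]]; apply/asboolP; split=> //.
  exists (fun i => if (i < n)%N then c i else 0).
  rewrite big_ord_recr /= ltnn scale0r addr0 yE.
  by apply: eq_bigr => i _; rewrite ltn_ord.
have /asboolP[_ [c]] : (x n : R^o) \in P n.
  rewrite -(nP n.+1 (leqnSn n)); apply/asboolP; split=> [j lt_jd|].
    by rewrite (hpart_hom dirR _ (Rx n)) ltn_eqF.
  exists (fun i => (i == n)%:R); rewrite (hpart_hom dirR _ (Rx n)) eqxx.
  rewrite big_ord_recr /= eqxx scale1r big1 ?add0r // => i _.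
  by rewrite ltn_eqF ?scale0r.
by rewrite (hpart_hom dirR _ (Rx n)) eqxx => /xN.
Qed.

Definition hspanning N := exists (b : 'I_N -> R) (w : 'I_N -> nat),
  (forall l, b l \in Rg (w l)) /\
  forall y, exists c : 'I_N -> k, y = \sum_l c l *: b l.

Lemma hspanning_exists : exists N, hspanning N.
Proof.
have [s sP] := graded_bounded.
have [n nP] := choice graded_part_finite.
have [x xP] := choice nP.
pose T : finType := {i : 'I_s & 'I_(n i)}.
pose b (t : T) : R := x (tag t) (tagged t).
exists #|{: T}|, (fun t => b (enum_val t)), (fun t => nat_of_ord (tag (enum_val t))).
split=> [t|y]; first exact: (xP _).1.
have cE (i : 'I_s) : exists c : nat -> k,
    hpart dirR i y = \sum_(j < n i) c j *: x i j.
  by apply: (xP i).2; apply: hpart_in.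
have [c {}cE] := choice cE.
pose cT (t : T) := c (tag t) (tagged t).
exists (fun t => cT (enum_val t)).
rewrite -(big_enum_val (fun t => cT t *: b t)) /=.
transitivity (\sum_(i < s) hpart dirR i y).
  rewrite -(big_mkord predT (fun i => hpart dirR i y)).
  apply: hpart_sum_over => [|i]; first exact: iota_uniq.
  rewrite mem_index_iota /= -leqNgt => le_si.
  exact: sP le_si (hpart_in _ _ _).
rewrite (eq_bigr _ (fun i _ => cE i)); exact: sig_big_dep.
Qed.

(** A homogeneous spanning family of the least possible size is independent: a
    nontrivial relation would allow dropping one of its members. *)
Lemma hombasis_exists : exists H : hombasis R,
  forall l : 'I_(hb_size H), hb_elt l \in Rg (hb_wt l).
Proof.
pose P N := `[< hspanning N >].
have exP : exists N, P N by have [N ?] := hspanning_exists; exists N; apply/asboolP.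
case: (ex_minnP exP) => N /asboolP[b [w [Rb bP]]] minN.
have bfree (c : 'I_N -> k) : \sum_l c l *: b l = 0 -> forall l, c l = 0.
  move=> c0 l0; apply/eqP; apply: contraT => cl0.
  case: N b w Rb bP minN c c0 l0 cl0 => [|N] b w Rb bP minN c c0 l0 cl0.
    by case: l0 cl0.
  suff /minN : P N by rewrite ltnn.
  apply/asboolP; exists (b \o lift l0), (w \o lift l0); split=> [l|y] /=.
    exact: Rb.
  have [e eE] := bP y.
  (* Subtract the multiple of the relation that cancels the coefficient at l0. *)
  exists (fun l => e (lift l0 l) - e l0 / c l0 * c (lift l0 l)).
  have : y = \sum_l (e l - e l0 / c l0 * c l) *: b l.
    under eq_bigr => l _ do rewrite scalerBl -scalerA.
    by rewrite sumrB -scaler_sumr c0 scaler0 subr0.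
  by rewrite (bigD1_ord l0) //= divfK // subrr scale0r add0r.
have coef0 d (c : 'I_N -> k) : \sum_l c l *: b l \in Rg d ->
    forall m, c m != 0 -> w m = d.
  move=> Rc m cm; apply/eqP; apply: contraNT cm => wm.
  have := hpart_hom dirR (w m) Rc; rewrite (negPf wm) raddf_sum /=.
  have E l : hpart dirR (w m) (c l *: b l) =
      (if w m == w l then c l else 0) *: b l.
    rewrite (hpart_hom dirR _ (Rg_scale (c l) (Rb l))).
    by case: ifP; rewrite ?scale0r.
  under eq_bigr => l _ do rewrite E.
  by move/bfree/(_ m); rewrite eqxx => /eqP.
suff mulP l l' : exists c : 'I_N -> k,
    (forall m, c m != 0 -> w m = (w l + w l')%N) /\ b l * b l' = \sum_m c m *: b m.
  have w0 l : w l = 0%N -> exists c : k, b l = c%:A.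
    by move=> wl; apply/Rg0; rewrite -wl.
  by exists (HomBasis bfree bP mulP w0).
have [c cE] := bP (b l * b l'); exists c; split=> //.
by apply: coef0; rewrite -cE RgM.
Qed.

End HomBasisExists.

(** * Graded free modules and ranks in a fixed degree *)

(** Matrices act on row vectors from the right, so this is exactness in the middle
    of the composite [x |-> x *m B *m C], except that [B *m C = 0] is left apart. *)
Definition mx_exact (R : comNzRingType) n m p (B : 'M[R]_(n, m)) (C : 'M[R]_(m, p)) :=
  forall x : 'rV_m, x *m C = 0 -> exists y, x = y *m B.

Section Graded.
Variables (k : fieldType) (R : comAlgType k) (H : hombasis R).
Local Notation r := (hb_size H).
Local Notation b := (@hb_elt _ _ H).
Local Notation w := (@hb_wt _ _ H).

Definition coord_of (x : R) : 'I_r -> k := projT1 (cid (hb_span H x)).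

Lemma coord_ofE x : x = \sum_l coord_of x l *: b l.
Proof. by rewrite /coord_of; case: cid. Qed.

Lemma coord_of_sum (c : 'I_r -> k) l : coord_of (\sum_l c l *: b l) l = c l.
Proof.
apply/eqP; rewrite -subr_eq0; apply/eqP; move: l; apply: hb_free.
under eq_bigr => l _ do rewrite scalerBl.
by rewrite sumrB -coord_ofE subrr.
Qed.

Lemma coord_ofP a x y l :
  coord_of (a *: x + y) l = a * coord_of x l + coord_of y l.
Proof.
rewrite -(coord_of_sum (fun l => a * coord_of x l + coord_of y l)).
congr (coord_of _ _); rewrite {1}[x]coord_ofE {1}[y]coord_ofE scaler_sumr.
by rewrite -big_split; apply: eq_bigr => m _; rewrite scalerA scalerDl.
Qed.

Lemma coord_of_inj x y : coord_of x =1 coord_of y -> x = y.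
Proof.
by move=> xy; rewrite [x]coord_ofE [y]coord_ofE; apply: eq_bigr => l _; rewrite xy.
Qed.

Lemma coord_of0 l : coord_of 0 l = 0.
Proof. by rewrite -(coord_of_sum (fun=> 0) l) big1 // => m _; rewrite scale0r. Qed.

(** Degrees are integers, so that they can be shifted freely; the parts of negative
    degree are zero. *)
Definition ring_part (e : int) (x : R) : R :=
  \sum_(l | (w l)%:Z == e) coord_of x l *: b l.

Definition homog e x := ring_part e x = x.

Lemma ring_part_is_linear e : linear (ring_part e).
Proof.
move=> a x y; rewrite /ring_part scaler_sumr -big_split; apply: eq_bigr => l _.
by rewrite coord_ofP scalerDl scalerA.
Qed.

HB.instance Definition _ e :=
  GRing.isLinear.Build k R R _ (ring_part e) (ring_part_is_linear e).

Lemma coord_ring_part e x l :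
  coord_of (ring_part e x) l = if (w l)%:Z == e then coord_of x l else 0.
Proof.
rewrite -(coord_of_sum (fun l => if (w l)%:Z == e then coord_of x l else 0)).
congr (coord_of _ _); rewrite /ring_part big_mkcond; apply: eq_bigr => m _.
by case: ifP => // _; rewrite scale0r.
Qed.

Lemma homogP e x : homog e x <-> forall l, coord_of x l != 0 -> (w l)%:Z = e.
Proof.
split=> [hx l|hx].
  by rewrite -hx coord_ring_part; case: ifP => [/eqP//|_]; rewrite eqxx.
apply: coord_of_inj => l; rewrite coord_ring_part; case: eqP => // wl.
by apply/esym/eqP; apply: contraT => /hx.
Qed.

Lemma ring_part_homog e x : homog e (ring_part e x).
Proof.
by apply/homogP => l; rewrite coord_ring_part; case: ifP => [/eqP//|_]; rewrite eqxx.
Qed.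

Lemma ring_partE e f x : homog f x -> ring_part e x = if e == f then x else 0.
Proof.
move=> hx; case: eqP => [->//|ef]; rewrite -hx; apply: coord_of_inj => l.
rewrite !coord_ring_part coord_of0; case: eqP => // we; case: eqP => // wf.
by case: ef; rewrite -we.
Qed.

Lemma homog_sum (I : finType) e (P : pred I) (F : I -> R) :
  (forall i, P i -> homog e (F i)) -> homog e (\sum_(i | P i) F i).
Proof. by move=> hF; rewrite /homog linear_sum; apply: eq_bigr. Qed.

Lemma homogZ e (c : k) x : homog e x -> homog e (c *: x).
Proof. by move=> hx; rewrite /homog linearZ /= hx. Qed.

Lemma homog_elt l : homog (w l)%:Z (b l).
Proof.
have -> : b l = \sum_m (m == l)%:R *: b m.
  rewrite (bigD1 l) //= eqxx scale1r big1 ?addr0 // => m /negPf->.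
  by rewrite scale0r.
by apply/homogP => m; rewrite coord_of_sum; case: (m =P l) => [->|]; rewrite ?eqxx.
Qed.

Lemma homogM e f x y : homog e x -> homog f y -> homog (e + f) (x * y).
Proof.
move=> hx hy; rewrite [x]coord_ofE [y]coord_ofE mulr_suml.
apply: homog_sum => l _; rewrite mulr_sumr; apply: homog_sum => m _.
rewrite -scalerAl -scalerAr.
have [->|/((homogP _ _).1 hx) <-] := eqVneq (coord_of x l) 0.
  by rewrite scale0r /homog linear0.
have [->|/((homogP _ _).1 hy) <-] := eqVneq (coord_of y m) 0.
  by rewrite scale0r scaler0 /homog linear0.
do 2!apply: homogZ; have [c [cP ->]] := hb_mul l m.
by apply/homogP => j; rewrite coord_of_sum => /cP->.
Qed.

Lemma ring_partM e f x y : homog f y ->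
  ring_part e (x * y) = ring_part (e - f) x * y.
Proof.
move=> hy; rewrite [x in LHS]coord_ofE mulr_suml linear_sum [ring_part (e - f) x]/ring_part.
rewrite mulr_suml.
rewrite [RHS]big_mkcond; apply: eq_bigr => l _ /=.
rewrite (ring_partE _ (homogM (homogZ _ (homog_elt l)) hy)).
by rewrite [in RHS]eq_sym subr_eq.
Qed.

Lemma ring_part_lt0 e x : (e < 0)%R -> ring_part e x = 0.
Proof. by move=> e0; rewrite /ring_part big1 // => l /eqP wl; move: e0; rewrite -wl. Qed.

Lemma homog0P x : homog 0 x -> exists c : k, x = c%:A.
Proof.
move=> hx; suff : exists c : 'I_r -> k, x = \sum_l (c l)%:A.
  by case=> c ->; exists (\sum_l c l); rewrite scaler_suml.
have cP l : exists c : k, coord_of x l *: b l = c%:A.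
  have [->|/((homogP _ _).1 hx) wl] := eqVneq (coord_of x l) 0.
    by exists 0; rewrite !scale0r.
  have [|c ->] := @hb_wt0 _ _ H l; first by case: wl.
  by exists (coord_of x l * c); rewrite scalerA.
have [c {}cP] := choice cP; exists c.
by rewrite [LHS]coord_ofE; apply: eq_bigr => l _; rewrite cP.
Qed.

(** The shift [u] is the degree of a generator: this decomposes the coefficient of
    that generator according to the total degree [d]. *)
Lemma ring_part_sum_over s u x : uniq s -> (forall l, u + (w l)%:Z \in s) ->
  \sum_(d <- s) ring_part (d - u) x = x.
Proof.
move=> us sP; rewrite [RHS]coord_ofE /ring_part.
under eq_bigr => d _ do rewrite big_mkcond.
rewrite exchange_big; apply: eq_bigr => l _ /=.
rewrite (bigD1_seq (u + (w l)%:Z)) //= addrAC subrr add0r eqxx.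
rewrite big1 ?addr0 // => d nd; case: eqP => // E.
by case/eqP: nd; rewrite E addrC subrK.
Qed.

(** The part of degree [d] in the graded free module whose [j]-th generator has
    degree [a j]. *)
Definition row_part n (a : 'I_n -> int) (d : int) (x : 'rV[R]_n) : 'rV[R]_n :=
  \row_j ring_part (d - a j) (x 0 j).

Definition degs n (a : 'I_n -> int) : seq int :=
  undup [seq a j + (w l)%:Z | j <- enum 'I_n, l <- enum 'I_r].

(** The condition for [x |-> x *m B] to preserve degrees. *)
Definition homog_mx n m (a : 'I_n -> int) (a' : 'I_m -> int) (B : 'M[R]_(n, m)) :=
  forall i j, homog (a i - a' j) (B i j).

Lemma row_part_sum n (a : 'I_n -> int) x : x = \sum_(d <- degs a) row_part a d x.
Proof.
apply/rowP => j; rewrite summxE.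
under eq_bigr => d _ do rewrite mxE.
rewrite ring_part_sum_over ?undup_uniq // => l; rewrite mem_undup.
by apply: allpairs_f; rewrite mem_enum.
Qed.

Lemma row_part0 n (a : 'I_n -> int) d : row_part a d 0 = 0.
Proof. by apply/rowP => j; rewrite !mxE linear0. Qed.

Lemma row_part_id n (a : 'I_n -> int) d x :
  row_part a d (row_part a d x) = row_part a d x.
Proof. by apply/rowP => j; rewrite !mxE; apply: ring_part_homog. Qed.

Lemma row_partM n m (a : 'I_n -> int) (a' : 'I_m -> int) B d x :
  homog_mx a a' B -> row_part a' d (x *m B) = row_part a d x *m B.
Proof.
move=> hB; apply/rowP => j; rewrite !mxE linear_sum; apply: eq_bigr => i _ /=.
by rewrite !mxE (ring_partM _ _ (hB i j)) opprB addrA subrK.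
Qed.

(** Dualizing a graded free module negates the degrees of its generators. *)
Lemma homog_mx_tr n m (a : 'I_n -> int) (a' : 'I_m -> int) B :
  homog_mx a a' B -> homog_mx (fun j => - a' j) (fun i => - a i) B^T.
Proof. by move=> hB i j; rewrite mxE opprK addrC; apply: hB. Qed.

(* coordinates over the ground field *)

Definition coords n (x : 'rV[R]_n) : 'M[k]_(n, r) :=
  \matrix_(j, l) coord_of (x 0 j) l.
Definition of_coords n (X : 'M[k]_(n, r)) : 'rV[R]_n :=
  \row_j \sum_l X j l *: b l.

Lemma coordsK n : cancel (@coords n) (@of_coords n).
Proof.
move=> x; apply/rowP => j; rewrite mxE [RHS]coord_ofE.
by apply: eq_bigr => l _; rewrite mxE.
Qed.

Lemma of_coordsK n : cancel (@of_coords n) (@coords n).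
Proof. by move=> X; apply/matrixP => j l; rewrite !mxE coord_of_sum. Qed.

Lemma of_coordsP n c (X Y : 'M[k]_(n, r)) :
  of_coords (c *: X + Y) = c%:A *: of_coords X + of_coords Y.
Proof.
apply/rowP => j; rewrite !mxE mulr_algl scaler_sumr -big_split.
by apply: eq_bigr => l _; rewrite !mxE scalerDl scalerA.
Qed.

Lemma coordsP n c (x y : 'rV[R]_n) :
  coords (c%:A *: x + y) = c *: coords x + coords y.
Proof. by apply/(can_inj (@of_coordsK n)); rewrite of_coordsP !coordsK. Qed.

Lemma coords0 n : coords (0 : 'rV[R]_n) = 0.
Proof. by have := coordsP (-1) (0 : 'rV[R]_n) 0; rewrite scaler0 addr0 scaleN1r addNr. Qed.

Lemma coords_sum n (I : Type) (s : seq I) (F : I -> 'rV[R]_n) :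
  coords (\sum_(i <- s) F i) = \sum_(i <- s) coords (F i).
Proof.
elim: s => [|i s IH]; first by rewrite !big_nil coords0.
by rewrite !big_cons -IH; have := coordsP 1 (F i) (\sum_(j <- s) F j); rewrite !scale1r.
Qed.

Lemma of_coords_sum n m (c : 'I_m -> k) (X : 'I_m -> 'M[k]_(n, r)) :
  of_coords (\sum_i c i *: X i) = \sum_i (c i)%:A *: of_coords (X i).
Proof.
apply/(can_inj (@coordsK n)); rewrite of_coordsK coords_sum; apply: eq_bigr => i _.
by rewrite -[_ *: of_coords _]addr0 coordsP coords0 addr0 of_coordsK.
Qed.

(** The homogeneous part of degree [d] of a graded free module, as a subspace of its
    space of coordinates over [k]. *)
Definition gpart n (a : 'I_n -> int) (d : int) : {vspace 'M[k]_(n, r)} :=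
  (\sum_(p : 'I_n * 'I_r | (a p.1 + (w p.2)%:Z == d)%R) <[delta_mx p.1 p.2]>)%VS.

Lemma gpartP n (a : 'I_n -> int) d X :
  X \in gpart a d <-> (forall j l, X j l != 0 -> a j + (w l)%:Z = d).
Proof.
split=> [/memv_sumP[v vP ->] j l|hX].
  apply: contraNeq => /eqP adl; rewrite summxE big1 // => p pd.
  have /vlineP[c ->] := vP p pd; rewrite !mxE.
  case: eqP => [jp|_]; last by rewrite mulr0.
  by case: eqP => [lp|_]; rewrite ?mulr0 //; case: adl; rewrite jp lp; apply/eqP.
rewrite [X]matrix_sum_delta pair_big; apply: rpred_sum => -[j l] _ /=.
have [->|/hX ad] := eqVneq (X j l) 0; first by rewrite scale0r mem0v.
rewrite -[_ *: _]add0r; apply: rpredD; first exact: mem0v.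
apply: memvZ; apply: (subvP (sumv_sup (j, l) _ (subvv _))) => /=.
  by rewrite ad.
exact: memv_line.
Qed.

Lemma mem_gpart n (a : 'I_n -> int) d x :
  coords x \in gpart a d <-> row_part a d x = x.
Proof.
split=> [/gpartP hx|hx].
  apply/rowP => j; rewrite mxE; apply/homogP => l cl.
  by rewrite -(hx j l) ?mxE // addrC addKr.
apply/gpartP => j l; rewrite mxE => cl.
have /homogP/(_ l cl)-> : homog (d - a j) (x 0 j).
  by move/rowP/(_ j): hx; rewrite mxE.
by rewrite addrC subrK.
Qed.

(** The number of pairs of a generator and a basis element of [R] whose degrees add
    up to [d]. *)
Definition gdim n (a : 'I_n -> int) (d : int) : nat :=
  (\sum_j \sum_l (a j + (w l)%:Z == d)%R)%N.

Lemma dim_gpart n (a : 'I_n -> int) d : \dim (gpart a d) = gdim a d.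
Proof.
have /directvP -> /= : directv (gpart a d).
  apply/directv_sum_independent => /= u uP u0 p Pp.
  have /vlineP[c uE] := uP p Pp.
  move/matrixP/(_ p.1 p.2): u0; rewrite summxE mxE (bigD1 p) //= uE !mxE !eqxx mulr1.
  rewrite big1 ?addr0 => [->|q /andP[Pq qp]]; first by rewrite scale0r.
  have /vlineP[e ->] := uP q Pq; rewrite !mxE.
  case: eqP => [q1|_]; last by rewrite mulr0.
  case: eqP => [q2|_]; last by rewrite mulr0.
  by move: qp; rewrite -pair_eqE /pair_eq -q1 -q2 !eqxx.
rewrite /gdim pair_big /= big_mkcond; apply: eq_bigr => p _.
case: eqP => //= _; rewrite dim_vline.
case: eqP => // /matrixP/(_ p.1 p.2)/eqP.
by rewrite !mxE !eqxx oner_eq0.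
Qed.

Definition coords_map n m (B : 'M[R]_(n, m)) (X : 'M[k]_(n, r)) : 'M[k]_(m, r) :=
  coords (of_coords X *m B).

Lemma coords_map_is_linear n m (B : 'M[R]_(n, m)) : linear (coords_map B).
Proof. by move=> c X Y; rewrite /coords_map of_coordsP mulmxDl -scalemxAl coordsP. Qed.

HB.instance Definition _ n m (B : 'M[R]_(n, m)) :=
  GRing.isLinear.Build k _ _ _ (coords_map B) (coords_map_is_linear B).

(** The rank over [k] of the map given by [B] between the parts of degree [d]. *)
Definition grank n m (a : 'I_n -> int) d (B : 'M[R]_(n, m)) :=
  \dim (linfun (coords_map B) @: gpart a d)%VS.

Section RankExact.
Variables (n m p : nat) (a : 'I_n -> int) (a' : 'I_m -> int) (a'' : 'I_p -> int).
Variables (B : 'M[R]_(n, m)) (C : 'M[R]_(m, p)).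
Hypotheses (hB : homog_mx a a' B) (hC : homog_mx a' a'' C) (BC : B *m C = 0).

Lemma gpart_im_ker d :
  (linfun (coords_map B) @: gpart a d <= gpart a' d :&: lker (linfun (coords_map C)))%VS.
Proof.
apply/subvP => _ /memv_imgP[X XV ->]; rewrite lfunE memv_cap memv_ker lfunE /=.
rewrite /coords_map coordsK -mulmxA BC mulmx0 coords0 eqxx andbT.
apply/mem_gpart; rewrite (row_partM _ _ hB); congr (_ *m _).
by apply/mem_gpart; rewrite of_coordsK.
Qed.

Lemma gpart_rank_nullity d :
  (\dim (gpart a' d :&: lker (linfun (coords_map C))) + grank a' d C)%N = gdim a' d.
Proof. by rewrite limg_ker_dim dim_gpart. Qed.

Lemma grank_complex d : (grank a d B + grank a' d C <= gdim a' d)%N.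
Proof. by rewrite -gpart_rank_nullity leq_add2r dimvS ?gpart_im_ker. Qed.

Lemma grank_exact d : mx_exact B C ->
  (grank a d B + grank a' d C)%N = gdim a' d.
Proof.
move=> ex; rewrite -gpart_rank_nullity; congr (_ + _)%N; apply/eqP.
rewrite eqn_leq !dimvS ?gpart_im_ker //; apply/subvP => X.
rewrite memv_cap memv_ker lfunE /= -[X]of_coordsK => /andP[/mem_gpart XV /eqP XC].
have [|y yE] := ex (of_coords X).
  by apply: (can_inj (@coordsK p)); rewrite coords0 -[RHS]XC /coords_map of_coordsK.
rewrite -XV yE (row_partM _ _ hB); apply/memv_imgP; exists (coords (row_part a d y)).
  by apply/mem_gpart; apply: row_part_id.
by rewrite lfunE /= /coords_map coordsK.
Qed.

(** An element of the kernel is the sum of its homogeneous parts.  Each of them lies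
    in the kernel because [C] preserves degrees, hence in the image by comparison of
    dimensions in that degree. *)
Lemma exact_grank : (forall d, (grank a d B + grank a' d C)%N = gdim a' d) ->
  mx_exact B C.
Proof.
move=> eq_rk x xC.
have comp d : exists y, row_part a' d x = y *m B.
  have : coords (row_part a' d x) \in (linfun (coords_map B) @: gpart a d)%VS.
    have /eqP-> : (linfun (coords_map B) @: gpart a d ==
                gpart a' d :&: lker (linfun (coords_map C)))%VS.
      rewrite eqEdim gpart_im_ker /= -(leq_add2r (grank a' d C)).
      by rewrite gpart_rank_nullity eq_rk.
    rewrite memv_cap memv_ker lfunE /= /coords_map coordsK.
    rewrite -(row_partM _ _ hC) xC row_part0 coords0 eqxx andbT.
    by apply/mem_gpart; apply: row_part_id.
  case/memv_imgP => Y _ /(congr1 (@of_coords m)); rewrite coordsK lfunE /= coordsK => ->.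
  by exists (of_coords Y).
have [y yE] := choice comp.
exists (\sum_(d <- degs a') y d); rewrite [LHS](row_part_sum a') mulmx_suml.
by apply: eq_bigr.
Qed.

End RankExact.

(** Both sides count the triples of a generator [j] and two basis elements of [R] of
    degrees [u], [v] with [u = d + v + a j]; the outer sums run over [v] and over
    [u] respectively.  This is the symmetry under [t -> 1/t] of the product of the
    Hilbert series of [R] with its own reflection. *)
Lemma gdim_dual n (a : 'I_n -> int) d :
  (\sum_l gdim (fun j => - a j)%R (d + (w l)%:Z)%R =
   \sum_l gdim a ((w l)%:Z - d)%R)%N.
Proof.
rewrite /gdim exchange_big [RHS]exchange_big; apply: eq_bigr => j _ /=.
rewrite exchange_big; apply: eq_bigr => l _; apply: eq_bigr => m _ /=.
by congr (nat_of_bool _); apply/eqP/eqP; lia.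
Qed.

End Graded.

(** * Graded free resolutions with growing degrees *)

Section GradedResolution.
Variables (k : fieldType) (R : comAlgType k) (H : hombasis R).
Local Notation r := (hb_size H).
Local Notation row_part := (row_part H).
Local Notation homog_mx := (homog_mx H).

(** A graded submodule of a graded free module, kept together with the free module
    and the degrees [gs_lab] of its generators, so that resolving it can be
    iterated. *)
Record graded_sub := GSub {
  gs_rk : nat;
  gs_lab : 'I_gs_rk -> int;
  gs_mem : 'rV[R]_gs_rk -> Prop;
  gs_mem0 : gs_mem 0;
  gs_memP : forall a x y, gs_mem x -> gs_mem y -> gs_mem (a *: x + y);
  gs_comp : forall d x, gs_mem x -> gs_mem (row_part gs_lab d x)
}.

Arguments gs_lab : clear implicits.
Arguments gs_mem : clear implicits.

Definition gs_above (S : graded_sub) (D : int) :=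
  forall d x, gs_mem S x -> row_part (gs_lab S) d x = x -> d < D -> x = 0.

(** Independence over [k], not over [R], is what is required: such generators are
    in general far from minimal, but they suffice to make degrees grow. *)
Definition hgens (S : graded_sub) (s : seq (int * 'M[k]_(gs_rk S, r))) :=
  free [seq p.2 | p <- s] /\ forall p, p \in s ->
    gs_mem S (of_coords p.2) /\ row_part (gs_lab S) p.1 (of_coords p.2) = of_coords p.2.

(** Take such a family of maximal length.  If it did not span, some homogeneous part
    of an element of the submodule could be added to it. *)
Lemma hgens_exist (S : graded_sub) : exists s : seq (int * 'M[k]_(gs_rk S, r)),
  hgens s /\ forall x, gs_mem S x -> coords H x \in <<[seq p.2 | p <- s]>>%VS.
Proof.
pose P m := `[< exists s : seq (int * 'M[k]_(gs_rk S, r)), hgens s /\ size s = m >].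
have P0 : P 0%N.
  apply/asboolP; exists [::]; split=> //; split=> //.
  by rewrite /free /= span_nil dimv0.
have Pub m : P m -> (m <= \dim {:'M[k]_(gs_rk S, r)})%N.
  move=> /asboolP[s [[frs _] <-]].
  by rewrite -(size_map snd) -(eqP frs) dimvS ?subvf.
case: (ex_maxnP (ex_intro _ 0%N P0) Pub) => m /asboolP[s [[frs gs] sm]] maxm.
exists s; split=> // x Kx.
rewrite [x](row_part_sum H (gs_lab S)) coords_sum; apply: memv_suml => d _.
apply: contraT => nin.
suff /maxm : P m.+1 by rewrite ltnn.
apply/asboolP; exists ((d, coords H (row_part (gs_lab S) d x)) :: s); rewrite /= sm.
split=> //; split=> [|p]; first by rewrite /= free_cons nin.
rewrite inE => /orP[/eqP->/=|]; last exact: gs.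
by rewrite coordsK row_part_id; split=> //; apply: gs_comp.
Qed.

(** One step of the resolution, with a homogeneous [k]-basis as generators.  If the
    submodule lives in degrees at least [D], so do the generators.  A relation of
    degree [D] among them then has coefficients in [R_0 = k], so it is trivial by
    independence over [k], and the relations live in degrees at least [D + 1]. *)
Lemma resolution_step (S : graded_sub) :
  exists T : {n & (('I_n -> int) * 'M[R]_(n, gs_rk S))%type},
  let: existT n (a, B) := T in
  [/\ homog_mx a (gs_lab S) B,
      forall x, gs_mem S x <-> exists y, x = y *m B
    & forall D, gs_above S D -> (forall i, D <= a i) /\
      forall d y, y *m B = 0 -> row_part a d y = y -> d < D + 1 -> y = 0].
Proof.
have [s [[frs gs] sP]] := hgens_exist S.
(* The default pair is never reached, as i ranges over the indices of s. *)
pose X (i : 'I_(size s)) : 'M[k]_(gs_rk S, r) := (nth (0, 0) s i).2.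
pose a (i : 'I_(size s)) : int := (nth (0, 0) s i).1.
pose B := \matrix_i of_coords (X i).
have XS i : gs_mem S (of_coords (X i)) by apply: (gs _ (mem_nth _ _)).1.
have Xa i : row_part (gs_lab S) (a i) (of_coords (X i)) = of_coords (X i).
  by apply: (gs _ (mem_nth _ _)).2.
have BE (c : 'I_(size s) -> k) :
    (\row_i (c i)%:A) *m B = of_coords (\sum_i c i *: X i).
  rewrite of_coords_sum; apply/rowP => j; rewrite !mxE summxE; apply: eq_bigr => i _.
  by rewrite !mxE.
have sz : size [seq p.2 | p <- s] == size s by rewrite size_map.
have XE (i : 'I_(size s)) : (Tuple sz)`_i = X i by rewrite /= (nth_map (0, 0)).
have Xfree (c : 'I_(size s) -> k) : \sum_i c i *: X i = 0 -> forall i, c i = 0.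
  have /freeP fr : free (Tuple sz) := frs.
  move=> c0; apply: fr; rewrite -[RHS]c0.
  by apply: eq_bigr => i _; rewrite XE.
exists (existT _ (size s) (a, B)); split=> [i j|x|D SD].
- by move/rowP/(_ j): (Xa i); rewrite !mxE.
- split=> [Kx|[y ->]].
    have := sP x Kx; rewrite -[[seq _ | _ <- s]]/(tval (Tuple sz)).
    move/coord_span => xE; exists (\row_i (coord (Tuple sz) i (coords H x))%:A).
    rewrite BE -[LHS](coordsK H) xE; congr of_coords; apply: eq_bigr => i _.
    by rewrite XE -xE.
  rewrite mulmx_sum_row; elim/big_ind: _ => [|u v Ku Kv|i _].
  - exact: gs_mem0.
  - by rewrite -[u]scale1r; apply: gs_memP.
  by rewrite rowK -[_ *: _]addr0; apply: gs_memP => //; apply: gs_mem0.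
have Da i : D <= a i.
  rewrite leNgt; apply/negP => /(SD _ _ (XS i) (Xa i)) X0.
  have : X i = 0.
    by rewrite -[LHS]of_coordsK X0 coords0.
  have /(_ (fun l => (l == i)%:R)) := Xfree.
  rewrite (bigD1 i) //= eqxx scale1r big1 => [|l /negPf->]; last exact: scale0r.
  rewrite addr0 => + Xi0 => /(_ Xi0 i) /eqP.
  by rewrite eqxx oner_eq0.
split=> // d y yB yd lt_d.
have yk i : exists c : k, y 0 i = c%:A.
  have : homog H (d - a i) (y 0 i).
    by move/rowP/(_ i): yd; rewrite mxE.
  have Dai := Da i; case: (ltgtP (a i) d) => [lt|lt|->]; first by lia.
  - move=> hy; rewrite -hy ring_part_lt0; last by lia.
    by exists 0; rewrite scale0r.
  by rewrite subrr; apply: homog0P.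
have [c cE] := choice yk.
have yE : y = \row_i (c i)%:A by apply/rowP => i; rewrite mxE cE.
have /Xfree c0 : \sum_i c i *: X i = 0.
  by rewrite -[LHS]of_coordsK -BE -yE yB coords0.
by apply/rowP => i; rewrite cE c0 scale0r mxE.
Qed.

Definition step_rk S : nat := projT1 (projT1 (cid (resolution_step S))).
Definition step_lab S : 'I_(step_rk S) -> int :=
  (projT2 (projT1 (cid (resolution_step S)))).1.
Arguments step_lab : clear implicits.
Definition step_mx S : 'M[R]_(step_rk S, gs_rk S) :=
  (projT2 (projT1 (cid (resolution_step S)))).2.

Lemma step_mxP S :
  [/\ homog_mx (step_lab S) (gs_lab S) (step_mx S),
      forall x, gs_mem S x <-> exists y, x = y *m step_mx S
    & forall D, gs_above S D -> (forall i, D <= step_lab S i) /\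
      forall d y, y *m step_mx S = 0 -> row_part (step_lab S) d y = y ->
        d < D + 1 -> y = 0].
Proof.
by rewrite /step_mx /step_lab /step_rk; case: cid => -[n [a B]].
Qed.

Lemma step_homog S : homog_mx (step_lab S) (gs_lab S) (step_mx S).
Proof. by case: (step_mxP S). Qed.
Arguments step_homog : clear implicits.

Section MatrixKernel.
Variables (n m : nat) (a : 'I_n -> int) (a' : 'I_m -> int) (B : 'M[R]_(n, m)).
Hypothesis hB : homog_mx a a' B.

Lemma mxker_memP c (x y : 'rV_n) :
  x *m B = 0 -> y *m B = 0 -> (c *: x + y) *m B = 0.
Proof. by move=> xB yB; rewrite mulmxDl -scalemxAl xB yB scaler0 addr0. Qed.

Lemma mxker_comp d (x : 'rV_n) : x *m B = 0 -> row_part a d x *m B = 0.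
Proof. by move=> xB; rewrite -(row_partM _ _ hB) xB row_part0. Qed.

Definition mxker : graded_sub :=
  @GSub n a (fun x : 'rV_n => x *m B = 0) (mul0mx _ _) mxker_memP mxker_comp.

End MatrixKernel.

Definition next_graded_sub S : graded_sub := mxker (step_homog S).

(** [syz S 0] is [S] itself; the free module around [syz S i] is the [i]-th term of
    the resolution, and [syz S i.+1] is the kernel of its [i]-th differential. *)
Fixpoint syz (S : graded_sub) i : graded_sub :=
  if i is j.+1 then next_graded_sub (syz S j) else S.

End GradedResolution.

Arguments gs_lab {k R H} g.
Arguments gs_mem {k R H} g.

(** * The Euler characteristic argument *)

Section SyzygyMatrices.
Variables (k : fieldType) (R : comAlgType k) (H : hombasis R).
Variable S : graded_sub H.

Definition syz_mx i : 'M[R]_(gs_rk (syz S i.+1), gs_rk (syz S i)) :=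
  step_mx (syz S i).

Lemma syz_mx_homog i :
  homog_mx H (gs_lab (syz S i.+1)) (gs_lab (syz S i)) (syz_mx i).
Proof. exact: step_homog. Qed.
Arguments syz_mx_homog : clear implicits.

Lemma syz_mx_mem i x : gs_mem (syz S i) x <-> exists y, x = y *m syz_mx i.
Proof. by case: (step_mxP (syz S i)) => _ + _; apply. Qed.
Arguments syz_mx_mem : clear implicits.

Lemma syz_mx_exact i : mx_exact (syz_mx i.+1) (syz_mx i).
Proof. by move=> x /(syz_mx_mem i.+1 x).1. Qed.

Arguments syz_mx_exact : clear implicits.

Lemma syz_mx_complex i : syz_mx i.+1 *m syz_mx i = 0.
Proof.
apply/row_matrixP => j; rewrite row_mul row0.
by apply: (syz_mx_mem i.+1 _).2; exists (delta_mx 0 j); rewrite rowE.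
Qed.

(** The linear growth of degrees that makes all Euler characteristics finite sums. *)
Lemma syz_mx_above D : gs_above S D ->
  forall i j, D + i%:Z <= gs_lab (syz S i.+1) j.
Proof.
move=> SD i; suff Di : gs_above (syz S i) (D + i%:Z).
  by case: (step_mxP (syz S i)) => _ _ /(_ _ Di)[].
elim: i => [|i IH]; first by rewrite addr0.
case: (step_mxP (syz S i)) => _ _ /(_ _ IH)[_ SDi] d x Kx dx lt_d.
apply: SDi Kx dx _; lia.
Qed.

Lemma gs_above_exists : exists D, gs_above S D.
Proof.
exists (- \sum_j `|gs_lab S j|) => d x _ dx lt_d; apply/rowP => j.
rewrite -dx !mxE ring_part_lt0 // subr_lt0 (lt_le_trans lt_d) // lerNl.
rewrite (bigD1 j) //= ler_wpDr ?sumr_ge0 //.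
by rewrite -normrN ler_norm.
Qed.

(** If [S] is the kernel of a presentation [F_0 -> M], this is the dual of [M] inside
    the dual of [F_0]. *)
Definition dual_graded_sub : graded_sub H := mxker (homog_mx_tr (syz_mx_homog 0)).

End SyzygyMatrices.

Arguments syz_mx_homog {k R H} S i.
Arguments syz_mx_mem {k R H} S i x.
Arguments syz_mx_exact {k R H} S i.
Arguments syz_mx_complex {k R H} S i.

Section DimensionBounds.
Variables (k : fieldType) (R : comAlgType k) (H : hombasis R).
Local Notation w := (@hb_wt _ _ H).
Local Notation W := (\sum_l w l)%N.

Lemma wt_le l : (w l <= W)%N.
Proof. by rewrite (bigD1 l) //= leq_addr. Qed.

Lemma gdim_lt n (a : 'I_n -> int) d : (forall j, d < a j) -> gdim H a d = 0%N.
Proof.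
move=> da; rewrite /gdim big1 // => j _; rewrite big1 // => l _.
by have := da j; case: eqP => //; lia.
Qed.

Lemma gdim_opp_lt n (a : 'I_n -> int) d :
  (forall j, W%:Z - d < a j) -> gdim H (fun j => - a j) d = 0%N.
Proof.
move=> da; rewrite /gdim big1 // => j _; rewrite big1 // => l _.
by have := da j; have := wt_le l; case: eqP => //; lia.
Qed.

Lemma grank_le n m (a : 'I_n -> int) d (B : 'M[R]_(n, m)) :
  (grank H a d B <= gdim H a d)%N.
Proof.
rewrite -dim_gpart /grank.
by rewrite -[X in (_ <= X)%N](limg_ker_dim (linfun (coords_map B))) leq_addl.
Qed.

Lemma hb_size_gt0 : exists l : 'I_(hb_size H), True.
Proof.
case: (posnP (hb_size H)) => [H0|H0]; last by exists (Ordinal H0).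
have [c /eqP] := hb_span H 1; rewrite big1 ?oner_eq0 // => -[l].
by move=> /[dup]; rewrite {1}H0.
Qed.

End DimensionBounds.

(** The terms [p 1], [p 2] and so on follow the term [p 0] in one direction, and
    [q 1], [q 2] in the other; [s i] and [r i] are the ranks of the maps between
    consecutive terms.  The ranks telescope; [delta], [eps] and [eta] are the
    dimensions of the homology. *)
Lemma alternating_sum (p q s r eps eta : nat -> int) (delta : int) N :
  p 0%N = r 0%N + s 0%N + delta ->
  (forall i, p i.+1 = s i + s i.+1 + eps i) ->
  (forall i, q i.+1 = r i + r i.+1 + eta i) ->
  p 0%N + \sum_(i < N) (-1) ^+ i.+1 * (p i.+1 + q i.+1) =
  delta + \sum_(i < N) (-1) ^+ i.+1 * (eps i + eta i) + (-1) ^+ N * (s N + r N).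
Proof.
move=> p0 pS qS; elim: N => [|N IH].
  by rewrite !big_ord0 p0 expr0; lia.
rewrite !big_ord_recr /= addrA IH pS qS exprS.
ring.
Qed.

Lemma sum_Posz (I : finType) (F : I -> nat) :
  \sum_i (F i)%:Z = (\sum_i F i)%N%:Z.
Proof. exact/esym/(big_morph Posz PoszD erefl). Qed.

Section EulerCharacteristic.
Variables (k : fieldType) (R : comAlgType k) (H : hombasis R) (S : graded_sub H).
Local Notation w := (@hb_wt _ _ H).
Local Notation W := (\sum_l w l)%N.
(* The modules F_i have generators of degrees [a i] and differentials [B i]; the
   modules H_i, which resolve the dual, have degrees [al i] and differentials
   [E i], and H_0 is the dual of F_0. *)
Local Notation T := (dual_graded_sub S).
Local Notation a i := (gs_lab (syz S i)).
Local Notation al i := (gs_lab (syz T i)).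
Local Notation B := (syz_mx S).
Local Notation E := (syz_mx T).
Local Notation opp f := (fun j => - f j).

(** Exactness of the dualized resolution at the dual of [F_(i+1)]. *)
Definition dual_exact i := mx_exact (B i)^T (B i.+1)^T.

(** Exactness of the dual of the glued complex at [F_0], for [i = 0], and at the dual
    of [H_i] otherwise. *)
Definition codual_exact i : Prop :=
  if i is j.+1 then mx_exact (E j)^T (E j.+1)^T else mx_exact (B 0) (E 0)^T.

Lemma opp_al0 : opp (al 0) = a 0.
Proof. by apply/funext => j /=; rewrite opprK. Qed.

Lemma E0_homog : homog_mx H (a 0) (opp (al 1)) (E 0)^T.
Proof. by have := homog_mx_tr (syz_mx_homog T 0); rewrite opp_al0. Qed.

Lemma E0B0 : E 0 *m (B 0)^T = 0.
Proof.
apply/row_matrixP => j; rewrite row_mul row0.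
by apply: (syz_mx_mem T 0 _).2; exists (delta_mx 0 j); rewrite rowE.
Qed.

Lemma trmx_complex n m p (X : 'M[R]_(n, m)) (Y : 'M[R]_(m, p)) :
  X *m Y = 0 -> Y^T *m X^T = 0.
Proof. by move=> XY; rewrite -trmx_mul XY trmx0. Qed.

Lemma B0E0 : B 0 *m (E 0)^T = 0.
Proof. by rewrite -[B 0]trmxK; apply: trmx_complex E0B0. Qed.

(** The dimensions of the homology in degree [d]; the subtractions are exact by
    [grank_complex]. *)
Definition dual_defect i d : nat := (gdim H (opp (a i.+1)) d -
  (grank H (opp (a i)) d (B i)^T + grank H (opp (a i.+1)) d (B i.+1)^T))%N.

Definition codual_defect i d : nat :=
  if i is j.+1 then (gdim H (opp (al j.+1)) d -
    (grank H (opp (al j)) d (E j)^T + grank H (opp (al j.+1)) d (E j.+1)^T))%N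
  else (gdim H (a 0) d - (grank H (a 1) d (B 0) + grank H (a 0) d (E 0)^T))%N.

Lemma dual_defectE i d : gdim H (opp (a i.+1)) d =
  (grank H (opp (a i)) d (B i)^T + grank H (opp (a i.+1)) d (B i.+1)^T +
   dual_defect i d)%N.
Proof.
rewrite subnKC // (grank_complex (homog_mx_tr (syz_mx_homog S i))) //.
by apply: trmx_complex; apply: syz_mx_complex.
Qed.

Lemma codual_defect0E d : gdim H (a 0) d =
  (grank H (a 1) d (B 0) + grank H (a 0) d (E 0)^T + codual_defect 0 d)%N.
Proof. by rewrite subnKC // (grank_complex (syz_mx_homog S 0)) // B0E0. Qed.

Lemma codual_defectSE i d : gdim H (opp (al i.+1)) d =
  (grank H (opp (al i)) d (E i)^T + grank H (opp (al i.+1)) d (E i.+1)^T +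
   codual_defect i.+1 d)%N.
Proof.
rewrite subnKC // (grank_complex (homog_mx_tr (syz_mx_homog T i))) //.
by apply: trmx_complex; apply: syz_mx_complex.
Qed.

Lemma dual_exactP i : dual_exact i <-> forall d, dual_defect i d = 0%N.
Proof.
have h1 := homog_mx_tr (syz_mx_homog S i); have h2 := homog_mx_tr (syz_mx_homog S i.+1).
have c := trmx_complex (syz_mx_complex S i).
split=> [ex d|e0]; last by apply: (exact_grank h1 h2 c) => d; rewrite dual_defectE e0 addn0.
by have := grank_exact h1 c d ex; rewrite dual_defectE; lia.
Qed.

Lemma codual_exactP i : codual_exact i <-> forall d, codual_defect i d = 0%N.
Proof.
case: i => [|i].
  have h1 := syz_mx_homog S 0; have c := B0E0.
  split=> [ex d|e0].
    by have := grank_exact h1 c d ex; rewrite codual_defect0E; lia.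
  by apply: (exact_grank h1 E0_homog c) => d; rewrite codual_defect0E e0 addn0.
have h1 := homog_mx_tr (syz_mx_homog T i); have h2 := homog_mx_tr (syz_mx_homog T i.+1).
have c := trmx_complex (syz_mx_complex T i).
split=> [ex d|e0]; last by apply: (exact_grank h1 h2 c) => d; rewrite codual_defectSE e0 addn0.
by have := grank_exact h1 c d ex; rewrite codual_defectSE; lia.
Qed.

(** The Euler characteristics in degree [d] of the glued complex and of its dual,
    cut off after [N] steps on both sides. *)
Definition euler_dual N d : int := (gdim H (opp (a 0)) d)%:Z + \sum_(i < N)
  (-1) ^+ i.+1 * ((gdim H (opp (a i.+1)) d)%:Z + (gdim H (al i.+1) d)%:Z).

Definition euler_codual N d : int := (gdim H (a 0) d)%:Z + \sum_(i < N)
  (-1) ^+ i.+1 * ((gdim H (a i.+1) d)%:Z + (gdim H (opp (al i.+1)) d)%:Z).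

Lemma euler_duality N d :
  \sum_l euler_dual N (d + (w l)%:Z) = \sum_l euler_codual N ((w l)%:Z - d).
Proof.
rewrite /euler_dual /euler_codual !big_split /=; congr (_ + _).
  by rewrite !sum_Posz gdim_dual.
rewrite exchange_big [RHS]exchange_big /=; apply: eq_bigr => i _.
rewrite -!mulr_sumr !big_split /= !sum_Posz gdim_dual.
have := gdim_dual H (al i.+1) (- d); rewrite opprK => E.
congr (_ * (_ + Posz _)); rewrite [RHS](eq_bigr
  (fun l => gdim H (opp (al i.+1)) (- d + (w l)%:Z))).
  by rewrite E; apply: eq_bigr => l _; rewrite addrC.
by move=> l _; rewrite addrC.
Qed.

(** For [N] large compared with [d] the cut-off is harmless: the generators of the
    terms beyond it have degrees too large, in the modules themselves or, after a
    change of sign, in their duals, for these terms to have a part of degree [d]. *)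
Lemma euler_defect : exists D, forall N (d : int), 2 * W%:Z + `|d| + D < N%:Z ->
  euler_dual N d = \sum_(i < N) (-1) ^+ i.+1 * (dual_defect i d)%:Z /\
  euler_codual N d = \sum_(i < N.+1) (-1) ^+ i * (codual_defect i d)%:Z.
Proof.
have [D1 D1P] := gs_above_exists S; have [D2 D2P] := gs_above_exists T.
exists (`|D1| + `|D2| + 2) => N d ltN.
have lab1 i (j : 'I_(gs_rk (syz S i.+1))) : (N <= i.+1)%N -> W%:Z + `|d| < a i.+1 j.
  by move=> leN; have := syz_mx_above D1P j; lia.
have lab2 i (j : 'I_(gs_rk (syz T i.+1))) : (N <= i.+1)%N -> W%:Z + `|d| < al i.+1 j.
  by move=> leN; have := syz_mx_above D2P j; lia.
have NE : N = N.-1.+1 by lia.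
split.
  rewrite /euler_dual (@alternating_sum (fun i => (gdim H (opp (a i)) d)%:Z)
   (fun i => (gdim H (al i) d)%:Z) (fun i => (grank H (opp (a i)) d (B i)^T)%:Z)
   (fun i => (grank H (al i.+1) d (E i))%:Z)
   (fun i => (dual_defect i d)%:Z) (fun=> 0) 0).
  - rewrite add0r [X in _ + X](_ : _ = 0) ?addr0.
      by apply: eq_bigr => i _; rewrite addr0.
    have -> : grank H (opp (a N)) d (B N)^T = 0%N.
      apply/eqP; rewrite -leqn0 (leq_trans (grank_le _ _ _ _)) //.
      rewrite NE gdim_opp_lt // => j; have := lab1 _ j; lia.
    have -> : grank H (al N.+1) d (E N) = 0%N.
      apply/eqP; rewrite -leqn0 (leq_trans (grank_le _ _ _ _)) //.
      by rewrite gdim_lt // => j; have := lab2 _ j; lia.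
    by rewrite addr0 mulr0.
  - rewrite addr0 -PoszD; congr Posz.
    by apply/esym; apply: (grank_exact (syz_mx_homog T 0) E0B0) => x /(syz_mx_mem T 0 x).1.
  - by move=> i; rewrite dual_defectE !PoszD.
  move=> i; rewrite addr0 addrC -PoszD; congr Posz; apply/esym.
  exact: (grank_exact (syz_mx_homog T i.+1) (syz_mx_complex T i) d (syz_mx_exact T i)).
rewrite /euler_codual (@alternating_sum (fun i => (gdim H (a i) d)%:Z)
   (fun i => (gdim H (opp (al i)) d)%:Z) 
   (fun i => (grank H (a i.+1) d (B i))%:Z)
   (fun i => (grank H (opp (al i)) d (E i)^T)%:Z)
   (fun=> 0) (fun i => (codual_defect i.+1 d)%:Z) (codual_defect 0 d)%:Z).
- rewrite [X in _ + X](_ : _ = 0) ?addr0.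
    by rewrite big_ord_recl expr0 mul1r; congr (_ + _).
  have -> : grank H (opp (al N)) d (E N)^T = 0%N.
    apply/eqP; rewrite -leqn0 (leq_trans (grank_le _ _ _ _)) //.
    rewrite NE gdim_opp_lt // => j; have := lab2 _ j; lia.
  have -> : grank H (a N.+1) d (B N) = 0%N.
    apply/eqP; rewrite -leqn0 (leq_trans (grank_le _ _ _ _)) //.
    by rewrite gdim_lt // => j; have := lab1 _ j; lia.
  by rewrite addr0 mulr0.
- by rewrite codual_defect0E opp_al0 !PoszD; congr (_ + _); rewrite addrC.
- move=> i; rewrite addr0 addrC -PoszD; congr Posz; apply/esym.
  exact: (grank_exact (syz_mx_homog S i.+1) (syz_mx_complex S i) d (syz_mx_exact S i)).
by move=> i; rewrite codual_defectSE !PoszD.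
Qed.

(** Under the parity hypothesis the homology contributes with sign [(-1)^p] to one
    Euler characteristic and with the opposite sign to the other, because exactness
    at the [i]-th place is indexed by [i.+1] in both cases but sits in homological
    degree [i.+1] in one complex and [i] in the other.  By [euler_duality] a sum of
    dimensions equals the negative of another one. *)
Theorem exact_of_parity (p : bool) :
  (forall i, odd i.+1 != p -> dual_exact i) ->
  (forall i, odd i.+1 != p -> codual_exact i) ->
  (forall i, dual_exact i) /\ (forall i, codual_exact i).
Proof.
move=> exF exH; have [D DP] := euler_defect.
have [l0 _] := hb_size_gt0 H.
suff all0 i (d : int) l :
    dual_defect i (d + (w l)%:Z) = 0%N /\ codual_defect i ((w l)%:Z - d) = 0%N.
  split=> i.
    by apply/dual_exactP => d; have [+ _] := all0 i (d - (w l0)%:Z) l0; rewrite subrK.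
  apply/codual_exactP => d; have [_] := all0 i ((w l0)%:Z - d) l0.
  by rewrite opprB addrC subrK.
(* N exceeds i and the bounds that euler_defect needs in all degrees d + w l' and
   w l' - d, whose absolute values are at most `|d| + W. *)
pose N := (i + absz (3 * W%:Z + `|d| + `|D| : int)).+1.
have lN l' : (2 * W%:Z + `|d + (w l')%:Z| + D < N%:Z) /\
    (2 * W%:Z + `|(w l')%:Z - d| + D < N%:Z).
  have := wt_le l'; rewrite /N; lia.
have sgn j : (-1) ^+ j.+1 = (-1) ^+ odd j.+1 :> int by rewrite signr_odd.
have epsS : \sum_l' euler_dual N (d + (w l')%:Z) =
    (-1) ^+ p * (\sum_l' \sum_(j < N) dual_defect j (d + (w l')%:Z))%N%:Z.
  rewrite -sum_Posz mulr_sumr; apply: eq_bigr => l' _.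
  rewrite (DP _ _ (lN l').1).1 -sum_Posz mulr_sumr; apply: eq_bigr => j _.
  rewrite sgn; have [->//|/exF/dual_exactP->] := eqVneq (odd j.+1) p.
  by rewrite !mulr0.
have kapS : \sum_l' euler_codual N ((w l')%:Z - d) =
    - ((-1) ^+ p * (\sum_l' \sum_(j < N.+1) codual_defect j ((w l')%:Z - d))%N%:Z).
  rewrite -sum_Posz mulr_sumr -sumrN; apply: eq_bigr => l' _.
  rewrite (DP _ _ (lN l').2).2 -sum_Posz mulr_sumr -sumrN; apply: eq_bigr => j _.
  have -> : (-1) ^+ j = - (-1) ^+ odd j.+1 :> int by rewrite -sgn exprS mulN1r opprK.
  rewrite mulNr.
  have [->//|/exH/codual_exactP->] := eqVneq (odd j.+1) p.
  by rewrite !mulr0.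
have := euler_duality N d; rewrite epsS kapS => /eqP.
rewrite -subr_eq0 opprK -mulrDr mulf_eq0 signr_eq0 /= -PoszD eqz_nat addn_eq0.
rewrite !sum_nat_eq0 => /andP[/forallP/(_ l) + /forallP/(_ l)].
rewrite /= !sum_nat_eq0.
have iN : (i < N)%N by rewrite /N; lia.
by move=> /forallP/(_ (Ordinal iN))/eqP-> /forallP/(_ (Ordinal (leqW iN)))/eqP->.
Qed.

End EulerCharacteristic.

(** * Duals, biduality and the transpose *)

Section Functionals.
Variable R : comNzRingType.

Definition pair_row n (u : 'rV[R]_n) (x : 'rV[R]_n) : R^o := (x *m u^T) 0 0.

Lemma pair_row_linear n (u : 'rV[R]_n) : linear (pair_row u).
Proof. by move=> a x y; rewrite /pair_row mulmxDl -scalemxAl !mxE. Qed.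

HB.instance Definition _ n (u : 'rV[R]_n) :=
  GRing.isLinear.Build R _ R^o _ (pair_row u) (pair_row_linear u).

Lemma pair_rowC n (u x : 'rV[R]_n) : pair_row u x = pair_row x u.
Proof. by rewrite /pair_row !mxE; apply: eq_bigr => i _; rewrite !mxE mulrC. Qed.

Lemma pair_rowM n m (B : 'M[R]_(n, m)) u x :
  pair_row u (x *m B) = pair_row (u *m B^T) x.
Proof. by rewrite /pair_row trmx_mul trmxK mulmxA. Qed.

Lemma pair_row_delta n (u : 'rV[R]_n) j : pair_row u (delta_mx 0 j) = u 0 j.
Proof. by rewrite /pair_row -rowE !mxE. Qed.

Lemma pair_row_inj n (u v : 'rV[R]_n) : pair_row u =1 pair_row v -> u = v.
Proof. by move=> uv; apply/rowP => j; rewrite -!pair_row_delta uv. Qed.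

Lemma pair_row_rep n (f : {linear 'rV[R]_n -> R^o}) :
  exists u, forall x, f x = pair_row u x.
Proof.
exists (\row_j f (delta_mx 0 j)) => x.
rewrite {1}[x]row_sum_delta linear_sum /pair_row mxE; apply: eq_bigr => j _.
by rewrite linearZ /= !mxE.
Qed.

Local Notation row_lin B := (mulmxr B : {linear 'rV[R]_ _ -> 'rV[R]_ _}).

Section MatrixResolution.
Variables (M : lmodType R) (n : nat -> nat) (B : forall i, 'M[R]_(n i.+1, n i)).
Variable aug : {linear 'rV[R]_(n 0) -> M}.
Hypotheses (aug_surj : Defs.surjective aug)
  (aug_ker : forall x, aug x = 0 <-> exists y, x = y *m B 0)
  (B_exact : forall i, mx_exact (B i.+1) (B i))
  (B_complex : forall i, B i.+1 *m B i = 0).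

Lemma mx_aug_exact : exact_at (row_lin (B 0)) aug.
Proof. by move=> x; rewrite aug_ker; split=> -[y]; exists y. Qed.

Lemma mx_diff_exact i : exact_at (row_lin (B i.+1)) (row_lin (B i)).
Proof.
move=> x /=; split=> [/B_exact[y ->]|[y <-]]; first by exists y.
by rewrite -mulmxA B_complex mulmx0.
Qed.

Definition mx_resolution : free_resolution M :=
  @FreeResolution R M n (fun i => row_lin (B i)) aug aug_surj mx_aug_exact
    mx_diff_exact.

Lemma mx_Ext_eq0P i :
  (forall x : Ext mx_resolution i.+1 R^o, x = 0) <-> mx_exact (B i)^T (B i.+1)^T.
Proof.
rewrite Ext_eq0P; split=> [E u uB|E f fB].
  have [|g gE] := E (pair_row u).
    by move=> x /=; rewrite pair_rowM uB /pair_row trmx0 mulmx0 mxE.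
  have [v vE] := pair_row_rep g; exists v; apply: pair_row_inj => x.
  by rewrite gE vE -pair_rowM.
have [u uE] := pair_row_rep f.
have [|v vE] := E u.
  apply: pair_row_inj => x; rewrite -pair_rowM -uE fB.
  by rewrite /pair_row trmx0 mulmx0 mxE.
by exists (pair_row v) => x /=; rewrite uE vE pair_rowM.
Qed.

Lemma mx_Ext_eq0 i : Ext_eq0 i.+1 M R^o <-> mx_exact (B i)^T (B i.+1)^T.
Proof.
split=> [[P E]|E]; last by exists mx_resolution; apply/mx_Ext_eq0P.
by apply/mx_Ext_eq0P; apply: (@Ext_eq0_indep _ _ _ mx_resolution P i E).
Qed.

End MatrixResolution.

Lemma bidualityE (M : lmodType R) (z : M) (psi : dual M) :
  hom_fun (biduality z) psi = hom_fun psi z.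
Proof. by []. Qed.

Section Duals.
Variables (M : lmodType R) (n : nat) (aug : {linear 'rV[R]_n -> M}).
Hypothesis aug_surj : Defs.surjective aug.

(** [M] is the quotient of the free module by the kernel of [aug]. *)
Lemma functional_descends (f : {linear 'rV[R]_n -> R^o}) :
  (forall x, aug x = 0 -> f x = 0) ->
  exists psi : dual M, forall x, hom_fun psi (aug x) = f x.
Proof.
move=> f0; have [s sP] := choice aug_surj.
have fs x y : aug x = aug y -> f x = f y.
  move=> xy; apply/eqP; rewrite -subr_eq0 -linearB; apply/eqP/f0.
  by rewrite linearB /= xy subrr.
have lin : linear (f \o s).
  by move=> a x y; rewrite /= -linearP; apply: fs; rewrite linearP /= !sP.
pose lm := GRing.isLinear.Build _ _ _ _ (f \o s) lin.
pose L : {linear M -> R^o} := HB.pack (f \o s) lm.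
by exists (to_hom L) => x; apply: fs; rewrite sP.
Qed.

Lemma dual_ext (psi chi : dual M) :
  (forall x, hom_fun psi (aug x) = hom_fun chi (aug x)) -> psi = chi.
Proof. by move=> E; apply/homP => z; have [x <-] := aug_surj z; apply: E. Qed.

Definition dual_row (psi : dual M) : 'rV[R]_n :=
  \row_j hom_fun psi (aug (delta_mx 0 j)).

Lemma dual_row_linear : linear dual_row.
Proof. by move=> a psi chi; apply/rowP => j; rewrite !mxE. Qed.

HB.instance Definition _ :=
  GRing.isLinear.Build R (dual M) _ _ dual_row dual_row_linear.

Lemma dual_rowE psi x : pair_row (dual_row psi) x = hom_fun psi (aug x).
Proof.
rewrite [x in RHS]row_sum_delta !linear_sum /pair_row mxE.
by apply: eq_bigr => j _; rewrite !linearZ /= !mxE.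
Qed.

Lemma dual_row_inj : injective dual_row.
Proof. by move=> psi chi E; apply: dual_ext => x; rewrite -!dual_rowE E. Qed.

Lemma dual_row_im u : (forall x, aug x = 0 -> pair_row u x = 0) ->
  exists psi, dual_row psi = u.
Proof.
move=> /functional_descends[psi psiE]; exists psi.
by apply: pair_row_inj => x; rewrite dual_rowE psiE.
Qed.

(* The rows of E generate the functionals on the free module that descend to M, so E
   presents the dual of M as a quotient of a free module. *)
Section DualAugmentation.
Variables (h : nat) (E : 'M[R]_(h, n)).
Hypothesis E_im : forall u, (exists y, u = y *m E) <->
  (forall x, aug x = 0 -> pair_row u x = 0).

Lemma dual_aug_ex y : exists psi, dual_row psi = y *m E.
Proof. by apply/dual_row_im/E_im; exists y. Qed.

Definition dual_aug y : dual M := projT1 (cid (dual_aug_ex y)).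

Lemma dual_augE y : dual_row (dual_aug y) = y *m E.
Proof. by rewrite /dual_aug; case: cid. Qed.

Lemma dual_aug_linear : linear dual_aug.
Proof.
by move=> a x y; apply: dual_row_inj; rewrite linearP /= !dual_augE mulmxDl scalemxAl.
Qed.

HB.instance Definition _ :=
  GRing.isLinear.Build R _ (dual M) _ dual_aug dual_aug_linear.

Lemma dual_aug_surj : Defs.surjective dual_aug.
Proof.
move=> psi; have [x x0|y yE] := (E_im (dual_row psi)).2.
  by rewrite dual_rowE x0 linear0.
by exists y; apply: dual_row_inj; rewrite dual_augE.
Qed.

Lemma dual_aug_ker y : dual_aug y = 0 <-> y *m E = 0.
Proof.
rewrite -dual_augE; split=> [->|y0]; first by rewrite linear0.
by apply: dual_row_inj; rewrite y0 linear0.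
Qed.

(** Under the pairing of row vectors, [x *m E^T = 0] says that all functionals on [M]
    vanish at [aug x]. *)
Lemma biduality_injP m (B : 'M[R]_(m, n)) :
  (forall x, aug x = 0 <-> exists y, x = y *m B) ->
  injective (@biduality R M) <-> mx_exact B E^T.
Proof.
move=> B_im; split=> [inj x xE|ex z1 z2 z12].
  apply/B_im/inj/homP => psi; rewrite !bidualityE linear0 -dual_rowE.
  have [y <-] := dual_aug_surj psi.
  by rewrite dual_augE pair_rowC pair_rowM xE /pair_row trmx0 mulmx0 mxE.
apply/eqP; rewrite -subr_eq0; have [x xE] := aug_surj (z1 - z2).
apply/eqP; rewrite -xE; apply/B_im/ex/pair_row_inj => y.
rewrite -pair_rowM pair_rowC -dual_augE dual_rowE xE linearB /=.
have /homP/(_ (dual_aug y)) := z12; rewrite !bidualityE => ->.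
by rewrite subrr /pair_row trmx0 mulmx0 mxE.
Qed.

(** A functional on the dual of [M] is a row vector [u] whose pairing with the rows of
    [E1] is zero; it is the evaluation at [aug x] exactly when [u = x *m E^T]. *)
Lemma biduality_surjP h1 (E1 : 'M[R]_(h1, h)) :
  (forall y : 'rV_h, y *m E = 0 <-> exists z, y = z *m E1) ->
  Defs.surjective (@biduality R M) <-> mx_exact E^T E1^T.
Proof.
move=> E1_im; split=> [surj u uE1|ex lam].
  pose f := pair_row u.
  have [s sP] := choice dual_aug_surj.
  have fs x y : dual_aug x = dual_aug y -> f x = f y.
    move=> xy; have /dual_aug_ker/E1_im[z zE] : dual_aug (x - y) = 0.
      by rewrite linearB /= xy subrr.
    apply/eqP; rewrite -subr_eq0 -linearB /= zE /f pair_rowM uE1.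
    by rewrite /pair_row trmx0 mulmx0 mxE.
  have lin : linear (f \o s).
    by move=> a x y; rewrite /= -linearP; apply: fs; rewrite linearP /= !sP.
  pose lm := GRing.isLinear.Build _ _ _ _ (f \o s) lin.
  pose L : {linear dual M -> R^o} := HB.pack (f \o s) lm.
  have [z zL] := surj (to_hom L); have [x xz] := aug_surj z.
  exists x; apply: pair_row_inj => y; rewrite -pair_rowM [RHS]pair_rowC.
  rewrite -dual_augE dual_rowE xz.
  have /homP/(_ (dual_aug y)) := zL; rewrite bidualityE => ->.
  by apply: fs; rewrite sP.
have [u uE] := pair_row_rep (hom_fun lam \o dual_aug).
have [|x xE] := ex u.
  apply: pair_row_inj => z; rewrite -pair_rowM -uE /=.
  have -> : dual_aug (z *m E1) = 0 by apply/dual_aug_ker/E1_im; exists z.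
  by rewrite linear0 /pair_row trmx0 mulmx0 mxE.
exists (aug x); apply/homP => psi; have [y <-] := dual_aug_surj psi.
by rewrite bidualityE -dual_rowE dual_augE pair_rowC pair_rowM -xE -uE.
Qed.

End DualAugmentation.
End Duals.

(* The kernel of the transposed presentation is the dual of M, so any resolution of
   the dual continues the transposed presentation to a resolution of Tr phi, with
   all degrees shifted by two. *)
Section TransposeResolution.
Variables (M : lmodType R) (phi : free_presentation M) (G : free_resolution (dual M)).
Local Notation m := (pres_src phi).
Local Notation n := (pres_tgt phi).
Local Notation Phi := (lin1_mx (pres_map phi)).
Local Notation aug := (pres_aug phi).

Lemma presE x : pres_map phi x = x *m Phi.
Proof. by rewrite mul_rV_lin1. Qed.

Definition tr_aug (u : 'rV[R]_m) : Tr phi := quot_proj _ (to_hom (pair_row u)).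

Lemma tr_aug_linear : linear tr_aug.
Proof.
move=> a u v; rewrite /tr_aug -linearP; congr quot_proj; apply/homP => x.
rewrite -[LHS]/(pair_row _ x) -[RHS]/(a *: pair_row u x + pair_row v x).
by rewrite pair_rowC linearP /= (pair_rowC x u) (pair_rowC x v).
Qed.

HB.instance Definition _ := GRing.isLinear.Build R _ (Tr phi) _ tr_aug tr_aug_linear.

Lemma tr_aug_surj : Defs.surjective tr_aug.
Proof.
move=> q; have [f <-] := quot_proj_surj q; have [u uE] := pair_row_rep (hom_fun f).
by exists u; congr quot_proj; apply/homP => x; rewrite uE.
Qed.

Lemma tr_aug_exact : exact_at (row_lin Phi^T) tr_aug.
Proof.
move=> u; have -> : (tr_aug u = 0) <->
    to_hom (pair_row u) \in im_pred (hom_map R^o (pres_map phi)).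
  by rewrite -[to_hom _ in X in _ <-> X]subr0 -quot_projE linear0; split=> /eqP.
split=> [/asboolP[g /homP gE]|[v <-]].
  have [v vE] := pair_row_rep (hom_fun g); exists v; apply: pair_row_inj => x /=.
  by rewrite -pair_rowM -presE -vE; apply: gE.
apply/asboolP; exists (to_hom (pair_row v)); apply/homP => x.
rewrite -[LHS]/(pair_row v (pres_map phi x)) -[RHS]/(pair_row (v *m Phi^T) x).
by rewrite presE pair_rowM.
Qed.

Definition tr_diff1 : 'rV[R]_(res_rank G 0) -> 'rV[R]_n := dual_row aug \o res_aug G.

HB.instance Definition _ := GRing.Linear.on tr_diff1.

Lemma tr_diff1_exact : exact_at tr_diff1 (row_lin Phi^T).
Proof.
move=> u /=; split=> [uP|[y <-]]; last first.
  apply: pair_row_inj => x; rewrite -pair_rowM dual_rowE -presE.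
  have -> : aug (pres_map phi x) = 0 by apply/pres_exact; exists x.
  by rewrite linear0 /pair_row trmx0 mulmx0 mxE.
have [x /pres_exact[y <-]|psi <-] := @dual_row_im _ _ _ (@pres_aug_surj _ _ phi) u.
  by rewrite presE pair_rowM uP /pair_row trmx0 mulmx0 mxE.
by have [y <-] := res_aug_surj G psi; exists y.
Qed.

Lemma tr_diff2_exact : exact_at (res_diff G 0) tr_diff1.
Proof.
move=> y; rewrite -(res_aug_exact y); split=> [|y0].
  by rewrite -(linear0 (dual_row aug)) => /(dual_row_inj (@pres_aug_surj _ _ phi)).
by rewrite -[LHS]/(dual_row aug (res_aug G y)) y0 linear0.
Qed.

Definition tr_rank i :=
  match i with 0 => m | 1 => n | j.+2 => res_rank G j end.

Definition tr_diff i : {linear 'rV[R]_(tr_rank i.+1) -> 'rV[R]_(tr_rank i)} :=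
  match i with 0 => row_lin Phi^T | 1 => tr_diff1 | j.+2 => res_diff G j end.

Lemma tr_diff_exact i : exact_at (tr_diff i.+1) (tr_diff i).
Proof.
case: i => [|[|i]]; [exact: tr_diff1_exact|exact: tr_diff2_exact|].
exact: res_diff_exact.
Qed.

Definition tr_resolution : free_resolution (Tr phi) :=
  @FreeResolution R (Tr phi) tr_rank tr_diff tr_aug tr_aug_surj tr_aug_exact
    tr_diff_exact.

(** A vector [v] of the free module whose image in [M] is killed by all functionals
    gives a cocycle of degree one; it is a coboundary exactly when [v] is a relation
    of [M]. *)
Lemma Ext1_Tr_injective : Ext_eq0 1 (Tr phi) R^o -> injective (@biduality R M).
Proof.
move=> [P /(@Ext_eq0_indep _ _ _ tr_resolution P 0)/Ext_eq0P E] z1 z2 z12.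
apply/eqP; rewrite -subr_eq0; have [v vE] := pres_aug_surj phi (z1 - z2).
have [|g gE] := E (pair_row v).
  move=> y; rewrite -[LHS]/(pair_row v (dual_row aug (res_aug G y))).
  rewrite pair_rowC dual_rowE vE linearB /=.
  by have /homP/(_ (res_aug G y)) := z12; rewrite !bidualityE => ->; rewrite subrr.
have [c cE] := pair_row_rep g; rewrite -vE; apply/eqP/pres_exact; exists c.
apply: pair_row_inj => x; rewrite presE gE cE.
by rewrite /= pair_rowM trmxK.
Qed.

(** A functional on the dual of [M] is a cocycle of degree two, and the coboundaries
    are the evaluations at elements of [M]. *)
Lemma Ext2_Tr_surjective : Ext_eq0 2 (Tr phi) R^o -> Defs.surjective (@biduality R M).
Proof.
move=> [P /(@Ext_eq0_indep _ _ _ tr_resolution P 1)/Ext_eq0P E] lam.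
have [|g gE] := E (hom_fun lam \o res_aug G).
  move=> y /=; have -> : res_aug G (res_diff G 0 y) = 0.
    by apply/res_aug_exact; exists y.
  by rewrite linear0.
have [v vE] := pair_row_rep g; exists (aug v); apply/homP => psi.
have [y <-] := res_aug_surj G psi.
by rewrite bidualityE; have /= -> := gE y; rewrite vE pair_rowC dual_rowE.
Qed.

Lemma Ext_Tr_dual i : Ext_eq0 i.+3 (Tr phi) R^o -> Ext_eq0 i.+1 (dual M) R^o.
Proof.
move=> [P /(@Ext_eq0_indep _ _ _ tr_resolution P i.+2)/Ext_eq0P E].
by exists G; apply/Ext_eq0P.
Qed.

End TransposeResolution.
End Functionals.

(** * Graded presentations *)

Section GradedPresentation.
Variables (k : fieldType) (R : comAlgType k) (Rg : nat -> zmodClosed R).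
Variables (M : lmodType R) (Mg : int -> zmodClosed M) (H : hombasis R).
Hypotheses (gradR : standard_graded Rg) (gradM : graded_module Rg Mg).
Hypothesis Hg : forall l : 'I_(hb_size H), hb_elt l \in Rg (hb_wt l).

Let dirM : direct_sum Mg. Proof. by case: gradM. Qed.

(** The homogeneous components of any finite set of generators generate. *)
Lemma graded_gens : finite_module M ->
  exists n (a : 'I_n -> int) (e : 'I_n -> M), (forall j, e j \in Mg (a j)) /\
    forall x, exists c : 'rV[R]_n, \sum_j c 0 j *: e j = x.
Proof.
move=> [n0 [e0 e0P]].
pose s := undup (flatten [seq hsupp dirM (e0 i) | i <- enum 'I_n0]).
pose T : finType := ('I_n0 * 'I_(size s))%type.
pose a (t : T) : int := nth 0 s t.2.
pose e (t : T) : M := hpart dirM (a t) (e0 t.1).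
exists #|{: T}|, (fun t => a (enum_val t)), (fun t => e (enum_val t)).
split=> [t|x]; first exact: hpart_in.
have [c ->] := e0P x; pose cT (t : T) := c t.1.
exists (\row_t cT (enum_val t)).
under eq_bigr => t _ do rewrite mxE.
rewrite -(big_enum_val (fun t => cT t *: e t)) /=.
transitivity (\sum_i \sum_j cT (i, j) *: e (i, j)).
  by rewrite pair_big; apply: eq_big => [|[]].
apply: eq_bigr => i _; rewrite [LHS](_ : _ = c i *: \sum_j e (i, j)).
  congr (_ *: _); rewrite [RHS](@hpart_sum_sub _ _ _ dirM s) ?undup_uniq //.
    by rewrite (big_nth 0) big_mkord.
  move=> d di; rewrite mem_undup; apply/flattenP; exists (hsupp dirM (e0 i)) => //.
  by apply: map_f; rewrite mem_enum.
by rewrite scaler_sumr.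
Qed.

Lemma hpart_scale d f y e : e \in Mg f ->
  hpart dirM d (y *: e) = ring_part H (d - f) y *: e.
Proof.
move=> Me; rewrite [y in LHS](coord_ofE H) scaler_suml raddf_sum /ring_part scaler_suml.
rewrite [RHS]big_mkcond; apply: eq_bigr => l _ /=.
have Ml : (coord_of y l *: hb_elt l) *: e \in Mg ((hb_wt l)%:Z + f).
  by case: gradM => _; apply=> //; apply: Rg_scale gradR _ _ _ (Hg l).
by rewrite (hpart_hom dirM _ Ml) [in RHS]eq_sym subr_eq.
Qed.

Section Presentation.
Variables (n : nat) (a : 'I_n -> int) (e : 'I_n -> M).
Hypothesis Me : forall j, e j \in Mg (a j).

Definition gen_map (x : 'rV[R]_n) : M := \sum_j x 0 j *: e j.

Lemma gen_map_linear : linear gen_map.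
Proof.
move=> c x y; rewrite /gen_map scaler_sumr -big_split; apply: eq_bigr => j _.
by rewrite !mxE scalerDl scalerA.
Qed.

HB.instance Definition _ := GRing.isLinear.Build R _ M _ gen_map gen_map_linear.

Lemma gen_map_comp d x : gen_map (row_part H a d x) = hpart dirM d (gen_map x).
Proof.
rewrite /gen_map raddf_sum; apply: eq_bigr => j _ /=.
by rewrite mxE (hpart_scale _ _ (Me j)).
Qed.

Lemma gen_ker_comp d x : gen_map x = 0 -> gen_map (row_part H a d x) = 0.
Proof. by move=> x0; rewrite gen_map_comp x0 raddf0. Qed.

Lemma gen_kerP c x y : gen_map x = 0 -> gen_map y = 0 -> gen_map (c *: x + y) = 0.
Proof. by move=> x0 y0; rewrite linearP /= x0 y0 scaler0 addr0. Qed.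

Definition gen_syz : graded_sub H :=
  @GSub k R H n a (fun x => gen_map x = 0) (linear0 _) gen_kerP gen_ker_comp.

End Presentation.
End GradedPresentation.

(** * Total reflexivity and exactness *)

(* The graded resolution of M and the one of its dual turn the conditions on M into
   exactness at single places of the two glued complexes. *)
Section Assembly.
Variables (k : fieldType) (R : comAlgType k) (H : hombasis R) (M : lmodType R).
Variables (S : graded_sub H) (aug : {linear 'rV[R]_(gs_rk S) -> M}).
Hypotheses (aug_surj : Defs.surjective aug)
  (aug_ker : forall x, gs_mem S x <-> aug x = 0).
Local Notation T := (dual_graded_sub S).

Let aug_kerE x : aug x = 0 <-> exists y, x = y *m syz_mx S 0.
Proof. by rewrite -aug_ker (syz_mx_mem S 0). Qed.

Lemma Ext_dual_exact i : Ext_eq0 i.+1 M R^o <-> dual_exact S i.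
Proof.
exact: (mx_Ext_eq0 aug_surj aug_kerE (syz_mx_exact S) (syz_mx_complex S)).
Qed.

Lemma syz_mx_dual_im u : (exists y, u = y *m syz_mx T 0) <->
  (forall x, aug x = 0 -> pair_row u x = 0).
Proof.
rewrite -(syz_mx_mem T 0 u); split=> [uB x /aug_kerE[y ->]|u0].
  by rewrite pair_rowM (uB : _ *m _ = 0) /pair_row trmx0 mulmx0 mxE.
apply: pair_row_inj => y; rewrite -pair_rowM u0; last by apply/aug_kerE; exists y.
by rewrite /pair_row trmx0 mulmx0 mxE.
Qed.

Lemma injective_codual_exact : injective (@biduality R M) <-> codual_exact S 0.
Proof. exact: (biduality_injP aug_surj syz_mx_dual_im aug_kerE). Qed.

Let dual_kerE (y : 'rV_(gs_rk (syz T 1))) :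
  y *m syz_mx T 0 = 0 <-> exists z, y = z *m syz_mx T 1.
Proof. exact: (syz_mx_mem T 1 y). Qed.

Lemma surjective_codual_exact :
  Defs.surjective (@biduality R M) <-> codual_exact S 1.
Proof. exact: (biduality_surjP aug_surj syz_mx_dual_im dual_kerE). Qed.

Let dual_aug_kerE (y : 'rV_(gs_rk (syz T 1))) :
  dual_aug aug_surj syz_mx_dual_im y = 0 <-> exists z, y = z *m syz_mx T 1.
Proof. by rewrite dual_aug_ker dual_kerE. Qed.

Lemma Ext_codual_exact i : Ext_eq0 i.+1 (dual M) R^o <-> codual_exact S i.+2.
Proof.
exact: (mx_Ext_eq0 (n := fun i => gs_rk (syz T i.+1)) (B := fun i => syz_mx T i.+1)
  (dual_aug_surj aug_surj syz_mx_dual_im) dual_aug_kerE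
  (fun i => syz_mx_exact T i.+1) (fun i => syz_mx_complex T i.+1)).
Qed.

Definition dual_resolution : free_resolution (dual M) :=
  @mx_resolution R (dual M) (fun i => gs_rk (syz T i.+1)) (fun i => syz_mx T i.+1) _
  (dual_aug_surj aug_surj syz_mx_dual_im) dual_aug_kerE
  (fun i => syz_mx_exact T i.+1) (fun i => syz_mx_complex T i.+1).

Lemma TR_dual_exact i : TR i.+1 M -> dual_exact S i.
Proof. by case=> + _ => /(_ isT)/Ext_dual_exact. Qed.

(** The presentation in [TR] is arbitrary, neither graded nor related to [S]; passing
    through conditions on [M] and its dual removes the dependence on it. *)
Lemma TR_codual_exact i : TR (- i.+1%:Z) M -> codual_exact S i.
Proof.
case=> _ []; first by lia.
move=> phi; have -> : `|- i.+1%:Z|%N = i.+1 by lia.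
case: i => [|[|i]].
- by move/(Ext1_Tr_injective dual_resolution)/injective_codual_exact.
- by move/(Ext2_Tr_surjective dual_resolution)/surjective_codual_exact.
by move/(Ext_Tr_dual dual_resolution)/Ext_codual_exact.
Qed.

Lemma totally_reflexive_exact : finite_module M -> (forall i, dual_exact S i) ->
  (forall i, codual_exact S i) -> totally_reflexive M.
Proof.
move=> finM exF exH; split=> [|[//|i] _|[//|i] _].
- split=> //.
  have inj := injective_codual_exact.2 (exH 0).
  have [g gP] := choice (surjective_codual_exact.2 (exH 1)).
  by exists g => x; [apply: inj|]; rewrite gP.
- exact/Ext_dual_exact.
exact/Ext_codual_exact.
Qed.

End Assembly.

Theorem proposition2p1 (k : fieldType) (R : comAlgType k)
    (Rg : nat -> zmodClosed R) (M : lmodType R) (Mg : int -> zmodClosed M)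
    (A : set int)
    (noethR : noetherian R) (artR : artinian R) (gradR : standard_graded Rg)
    (finM : finite_module M) (gradM : graded_module Rg Mg)
    (finA : finite_set A)
    (parityA : (forall a, A a -> (2 %| a)%Z) \/
               (forall a, A a -> ~~ (2 %| a)%Z))
    (trM : forall i : int, i != 0 -> ~ A i -> TR i M) :
  totally_reflexive M.
Proof.
have [H Hg] := hombasis_exists noethR artR gradR.
have [n [a [e [Me eP]]]] := graded_gens gradM finM.
pose S := gen_syz gradR gradM Hg Me.
pose aug : {linear 'rV[R]_(gs_rk S) -> M} := gen_map e.
have aug_surj : Defs.surjective aug by exact: eP.
have aug_ker x : gs_mem S x <-> aug x = 0 by [].
have dvd2 i : (2 %| i%:Z)%Z = ~~ odd i by rewrite dvdzE /= dvdn2.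
have dvd2N i : (2 %| - i%:Z)%Z = ~~ odd i by rewrite dvdzE abszN /= dvdn2.
have [p pA] : exists p : bool, forall i : nat,
    odd i != p -> ~ A i%:Z /\ ~ A (- i%:Z).
  case: parityA => evA; [exists false|exists true] => i.
    by rewrite eqbF_neg negbK => oi; split=> /evA; rewrite ?dvd2 ?dvd2N oi.
  by rewrite eqb_id => oi; split=> /evA; rewrite ?dvd2 ?dvd2N oi.
have [i pi|i pi|exF exH] := @exact_of_parity _ _ H S p.
- by apply: (TR_dual_exact aug_surj aug_ker); apply: trM => //; have [] := pA _ pi.
- by apply: (TR_codual_exact aug_surj aug_ker); apply: trM => //; have [] := pA _ pi.
exact: totally_reflexive_exact aug_surj aug_ker finM exF exH.
Qed.
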